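(* Let $\mathbb K$ be a field of characteristic $0$, let $R=\mathbb K[x_1,\ldots,x_k]$, and let $\mathcal A=\{\ell_1,\ldots,\ell_n\}\subset R$ be a hyperplane arrangement with $n\ge 2$ (linear forms, no two proportional). Then $R/I_{n-2}(\mathcal A)$ is (arithmetically) Cohen-Macaulay if and only if one of the following holds: (1) ${\rm rank}(\mathcal A)=2$ and $p(\mathcal A)=\binom{n-1}{2}$; or (2) ${\rm rank}(\mathcal A)\ge 3$ and $p(\mathcal A)=0$ (i.e., $\mathcal A$ is 3-generic: any three linear forms of $\mathcal A$ are linearly independent).
   Context: For $1\le a\le n$, $I_a(\mathcal A)$ is the ideal of $R$ generated by all products $\ell_{i_1}\cdots\ell_{i_a}$ with $1\le i_1<\cdots<i_a\le n$; by convention $I_0(\mathcal A)=R$ (and the zero module is regarded as Cohen-Macaulay). The rank of $\mathcal A$ is the height of the ideal $\langle\ell_1,\ldots,\ell_n\rangle$, i.e. the dimension of the $\mathbb K$-span of $\ell_1,\ldots,\ell_n$. A 3-dependency of $\mathcal A$ is a relation $c_{i_1}\ell_{i_1}+c_{i_2}\ell_{i_2}+c_{i_3}\ell_{i_3}=0$ with $1\le i_1<i_2<i_3\le n$ and $c_{i_1},c_{i_2},c_{i_3}\in\mathbb K\setminus\{0\}$. Index the coordinates of $\mathbb K^m$, $m=\binom n2$, by the pairs $(i,j)$ with $1\le i<j\le n$. To each 3-dependency associate the vector in $\mathbb K^m$ whose $(i_1,i_2)$-entry is $c_{i_3}$, whose $(i_1,i_3)$-entry is $c_{i_2}$, whose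 $(i_2,i_3)$-entry is $c_{i_1}$, and whose other entries are $0$. Then $p(\mathcal A)$ is the dimension of the $\mathbb K$-linear span in $\mathbb K^m$ of all these vectors. *)

(* Defs.v *)
From Stdlib Require Import Classical ClassicalEpsilon.
From HB Require Import structures.
From mathcomp Require Import all_boot all_order all_algebra.
From mathcomp Require Import mpoly.

Set Implicit Arguments.
Unset Strict Implicit.
Unset Printing Implicit Defensive.

Import GRing.Theory.
Local Open Scope ring_scope.

(* Ideals are Prop-valued predicates: no decidability of membership is
   assumed, unlike for the boolean idealr of ring_quotient. *)
Section CommutativeAlgebra.
Variable R : comNzRingType.
Implicit Types I J P : R -> Prop.

Definition is_ideal J : Prop :=
  [/\ J 0, forall a b, J a -> J b -> J (a + b) & forall r a, J a -> J (r * a)].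

(* The intersection of all ideals containing G. *)
Definition ideal_gen (G : R -> Prop) : R -> Prop :=
  fun f => forall J, is_ideal J -> (forall g, G g -> J g) -> J f.

Definition is_prime_ideal P : Prop :=
  [/\ is_ideal P, ~ P 1 & forall a b, P (a * b) -> P a \/ P b].

Definition is_max (A : nat -> Prop) (d : nat) : Prop :=
  A d /\ forall e, A e -> (e <= d)%N.

(* Primes of R / I are taken as the primes of R containing I. *)
Definition has_prime_chain I (d : nat) : Prop :=
  exists P : nat -> R -> Prop,
    (forall i, (i <= d)%N ->
       is_prime_ideal (P i) /\ (forall f, I f -> P i f)) /\
    (forall i, (i < d)%N ->
       (forall f, P i f -> P i.+1 f) /\ ~ (forall f, P i.+1 f -> P i f)).

Definition krull_dim_quot I (d : nat) : Prop := is_max (has_prime_chain I) d.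

Definition ideal_adjoin I (s : seq R) : R -> Prop :=
  ideal_gen (fun f => I f \/ f \in s).

(* s is a regular sequence on the R-module M = R / I: each s`_i is a
   nonzerodivisor on M / (s`_0, ..., s`_(i-1)) M, and M <> s M. *)
Definition regular_sequence_quot I (s : seq R) : Prop :=
  (forall i, (i < size s)%N -> forall g,
     ideal_adjoin I (take i s) (s`_i * g) -> ideal_adjoin I (take i s) g) /\
  ~ ideal_adjoin I s 1.

Definition depth_quot (m I : R -> Prop) (d : nat) : Prop :=
  is_max (fun e => exists s : seq R,
    [/\ size s = e, forall f, f \in s -> m f & regular_sequence_quot I s]) d.

(* depth_m (R / I) = dim (R / I), the zero module being Cohen-Macaulay. *)
Definition cohen_macaulay_quot (m I : R -> Prop) : Prop :=
  I 1 \/ exists d, krull_dim_quot I d /\ depth_quot m I d.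

End CommutativeAlgebra.

Section LinearSpan.
Variables (F : fieldType) (V : vectType F).

Definition is_linear_span (S : V -> Prop) (U : {vspace V}) : Prop :=
  (forall v, S v -> v \in U) /\
  (forall W : {vspace V}, (forall v, S v -> v \in W) -> (U <= W)%VS).

(* The span of a possibly infinite set of vectors. *)
Definition linear_span (S : V -> Prop) : {vspace V} :=
  epsilon (inhabits 0%VS) (is_linear_span S).

Lemma linear_spanP (S : V -> Prop) : is_linear_span S (linear_span S).
Proof.
apply: epsilon_spec.
suff ext m (U : {vspace V}) : (\dim {:V} - \dim U <= m)%N ->
    (forall W : {vspace V}, (forall v, S v -> v \in W) -> (U <= W)%VS) ->
    exists U', is_linear_span S U'.
  by apply: (ext _ 0%VS (leqnn _)) => W _; apply: sub0v.
elim: m U => [|m IHm] U leUm minU.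
  exists U; split=> // v _.
  have /eqP-> : U == fullv by rewrite eqEdim subvf -subn_eq0 -leqn0.
  by rewrite memvf.
have [sSU | nSU] := classic (forall v, S v -> v \in U); first by exists U.
have [v nSv] := not_all_ex_not _ _ nSU.
have [Sv /negP Uv] := imply_to_and _ _ nSv.
have minUv (W : {vspace V}) : (forall w, S w -> w \in W) -> (U + <[v]> <= W)%VS.
  by move=> sSW; rewrite subv_add minU // -memvE sSW.
apply: IHm minUv.
have ltU : (\dim U < \dim (U + <[v]>))%N.
  rewrite ltn_neqAle dimvS ?addvSl // andbT; apply: contra Uv => /eqP eqd.
  have /eqP-> : U == (U + <[v]>)%VS by rewrite eqEdim addvSl eqd /=.
  by apply: subvP (addvSr U _) _ (memv_line v).
rewrite -ltnS; apply: leq_trans leUm.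
by apply: ltn_sub2l => //; apply: leq_trans ltU (dimvS (subvf _)).
Qed.

End LinearSpan.

Section Arrangement.
Variables (K : fieldType) (k n : nat).
Implicit Type l : 'I_n -> {mpoly K[k]}.

(* 0 is homogeneous of every degree, hence the second condition. *)
Definition hyperplane_arrangement l : Prop :=
  [/\ forall i, l i \is 1.-homog,
      forall i, l i != 0
    & forall i j, i != j -> forall c : K, l i <> c *: l j].

Definition product_ideal l (a : nat) : {mpoly K[k]} -> Prop :=
  ideal_gen (fun f =>
    exists A : {set 'I_n}, #|A| = a /\ f = \prod_(i in A) l i).

Definition irrelevant_ideal : {mpoly K[k]} -> Prop :=
  ideal_gen (fun f => exists j : 'I_k, f = 'X_j).

(* The dimension of the K-span of the l i, computed on their coordinates in
   the basis 'X_0, ..., 'X_(k-1) of linear forms. *)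
Definition arrangement_rank l : nat :=
  \rank (\matrix_(i < n, j < k) (l i)@_U_(j)).

Definition ord_pair : finType := {p : 'I_n * 'I_n | (p.1 < p.2)%N}.

Definition is_3dependency l (i1 i2 i3 : 'I_n) (c1 c2 c3 : K) : Prop :=
  [/\ (i1 < i2 < i3)%N, [/\ c1 != 0, c2 != 0 & c3 != 0]
    & c1 *: l i1 + c2 *: l i2 + c3 *: l i3 = 0].

(* {ffun ord_pair -> K^o} is K^m with m = 'C(n, 2). *)
Definition dependency_vector (i1 i2 i3 : 'I_n) (c1 c2 c3 : K) :
    {ffun ord_pair -> K^o} :=
  [ffun p => if val p == (i1, i2) then c3
             else if val p == (i1, i3) then c2
             else if val p == (i2, i3) then c1
             else 0].

Definition is_dependency_vector l (v : {ffun ord_pair -> K^o}) : Prop :=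
  exists (i1 i2 i3 : 'I_n) (c1 c2 c3 : K),
    is_3dependency l i1 i2 i3 c1 c2 c3 /\
    v = dependency_vector i1 i2 i3 c1 c2 c3.

Definition dependency_dim l : nat := \dim (linear_span (is_dependency_vector l)).

Definition three_generic l : Prop :=
  forall i1 i2 i3 : 'I_n, (i1 < i2 < i3)%N -> forall c1 c2 c3 : K,
    c1 *: l i1 + c2 *: l i2 + c3 *: l i3 = 0 -> [/\ c1 = 0, c2 = 0 & c3 = 0].

End Arrangement.

Arguments irrelevant_ideal : clear implicits.

(* Main.v *)
Require Import Defs.
From Stdlib Require Import Classical ClassicalEpsilon FunctionalExtensionality.
From HB Require Import structures.
From mathcomp Require Import all_boot all_order all_algebra.
From mathcomp Require Import mpoly ring zify.

Set Implicit Arguments.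
Unset Strict Implicit.
Unset Printing Implicit Defensive.

Import Order.TTheory GRing.Theory.
Local Open Scope ring_scope.

(** Let R be the polynomial ring, m its irrelevant ideal and I the ideal of the
    (n-2)-fold products.

    Let B be a list of linear forms any c of which are independent.  The products of
    all but c - 1 members of B generate an ideal (star_ideal) that cuts out the union
    of the linear spaces on which c members of B vanish.  For a member b of B, the sum
    of this ideal with (b) and its colon by b are again ideals of this kind, modulo b
    and for the remaining members respectively.  So the quotient ring is filtered by
    copies of rings R / (c independent forms), and a linear form outside the span of
    any c members is a nonzerodivisor (star_ideal_regular).  Over an infinite field
    there are k - c forms in general position with B, so the quotient has depth k - c,
    which is also its dimension (star_ideal_cohen_macaulay).  When A is 3-generic of
    rank at least 3, I is this ideal for B = A and c = 3.  In rank 2 with n > 2 any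
    three forms are dependent, so one form can be eliminated from every product, and I
    is this ideal for c = 2 and the other n - 1 forms; for n = 2 it is R.

    Suppose now that the rank is at least 3 and that three forms are dependent.  Every
    (n-2)-fold product involves one of these three, so I lies in the prime generated
    by two forms and R / I has dimension at least k - 2.  Let f be the product of all
    forms but three independent ones.  Its degree n - 3 is too small for f to vanish
    in R / I, even after localization at m, but the three omitted forms multiply f
    into I.  A regular sequence in m on R / I yields a chain of primes of the same
    length above the annihilator of f (regular_sequence_chain), hence above three
    independent linear forms; so its length is at most k - 3 (prime_chain_length), and
    R / I is not Cohen-Macaulay.

    The chain of primes is built with associated primes, which exist by Hilbert's
    basis theorem (mpoly_noetherian).  The bound on its length is the bound on the
    Krull dimension of a polynomial ring: elements picked along a chain are
    algebraically independent modulo its first prime, and there are at most as many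
    of these as variables.

    It remains to compute p(A).  It vanishes exactly when there is no 3-dependency.
    In rank 2, forgetting the coordinates at the pairs that contain the first index
    maps the span of the dependency vectors isomorphically onto the space of the other
    coordinates, which has dimension 'C(n - 1, 2): it is onto since the first form is
    dependent on any two others, and injective since every vector u of the span is a
    relation between the products of n - 2 forms (dependency_relation_span), while the
    products omitting the first form and one other are independent. *)

(** * Ideals and ascending chains *)

Section Ideals.
Variable R : comNzRingType.
Implicit Types (I J P Q : R -> Prop) (G : R -> Prop).

Lemma ideal_opp I a : is_ideal I -> I a -> I (- a).
Proof. by case=> _ _ IM Ia; rewrite -mulN1r; apply: IM. Qed.

Lemma ideal_sub I a b : is_ideal I -> I a -> I b -> I (a - b).
Proof.
by move=> idI Ia Ib; case: (idI) => _ ID _; apply: ID Ia _; apply: ideal_opp.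
Qed.

Lemma ideal_mulr I a r : is_ideal I -> I a -> I (a * r).
Proof. by case=> _ _ IM Ia; rewrite mulrC; apply: IM. Qed.

Lemma ideal_sum I (T : Type) (s : seq T) (A : pred T) (F : T -> R) :
  is_ideal I -> (forall t, A t -> I (F t)) -> I (\sum_(t <- s | A t) F t).
Proof. by case=> I0 ID _ IF; apply: (big_ind I) => //. Qed.

Lemma ideal_gen_ideal G : is_ideal (ideal_gen G).
Proof.
split=> [J [] // | a b Ga Gb J idJ GJ | r a Ga J idJ GJ].
  by case: (idJ) => _ JD _; apply: JD; [apply: Ga | apply: Gb].
by case: (idJ) => _ _; apply; apply: Ga.
Qed.

Lemma ideal_gen_mem G g : G g -> ideal_gen G g.
Proof. by move=> Gg J _; apply. Qed.

Lemma ideal_genS G G' f :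
  (forall g, G g -> G' g) -> ideal_gen G f -> ideal_gen G' f.
Proof. by move=> sGG' Gf J idJ G'J; apply: Gf => // g /sGG'/G'J. Qed.

(** The ascending chain condition in the form in which it is proved and used: a
    sequence has a term generated by the earlier ones. *)
Definition noetherian : Prop :=
  forall f : nat -> R, exists j,
    ideal_gen (fun g => exists2 i, (i < j)%N & g = f i) (f j).

Lemma noetherian_max (C : (R -> Prop) -> Prop) :
    noetherian -> (forall I, C I -> is_ideal I) -> (exists I, C I) ->
  exists2 I, C I &
    forall J, C J -> (forall f, I f -> J f) -> forall f, J f -> I f.
Proof.
move=> noeR idC [I0 C0]; apply: NNPP => nomax.
have next (S : {I | C I}) : exists T : {I | C I},
    (forall f, sval S f -> sval T f) /\ exists x, sval T x /\ ~ sval S x.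
  case: S => I CI; apply: NNPP => noT; apply: nomax; exists I => // J CJ sIJ f Jf.
  apply: NNPP => nIf; apply: noT; exists (exist _ J CJ).
  by split=> //; exists f.
pose nx S := sval (constructive_indefinite_description _ (next S)).
pose S := fix S n := if n is n'.+1 then nx (S n') else exist _ I0 C0.
have SP n : (forall f, sval (S n) f -> sval (S n.+1) f) /\
    exists x, sval (S n.+1) x /\ ~ sval (S n) x.
  exact: svalP (constructive_indefinite_description _ (next (S n))).
have Smono i j : (i <= j)%N -> forall f, sval (S i) f -> sval (S j) f.
  by move/subnK <-; elim: (j - i)%N => // d IHd f /IHd; apply: (SP _).1.
pose x n := sval (constructive_indefinite_description _ (SP n).2).
have xP n : sval (S n.+1) (x n) /\ ~ sval (S n) (x n).
  exact: svalP (constructive_indefinite_description _ (SP n).2).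
have [j xj] := noeR x; apply: (xP j).2; apply: xj; first exact: idC (svalP (S j)).
by move=> _ [i ltij ->]; apply: Smono ltij _ (xP i).1.
Qed.

End Ideals.

(** * Hilbert's basis theorem *)

Lemma nondecreasing_subseq (h : nat -> nat) :
  exists phi : nat -> nat, {homo phi : i j / (i < j)%N} /\
    {homo h \o phi : i j / (i <= j)%N}.
Proof.
have next N : exists i, (N <= i)%N /\ forall j, (N <= j)%N -> (h i <= h j)%N.
  suff min m : (exists2 i, (N <= i)%N & (h i <= m)%N) ->
      exists i, (N <= i)%N /\ forall j, (N <= j)%N -> (h i <= h j)%N.
    by apply: (min (h N)); exists N.
  elim: m => [|m IHm] [i leNi him].
    by exists i; split=> // j _; move: him; rewrite leqn0 => /eqP ->.
  have [[j leNj hjm] | nex] := classic (exists2 i, (N <= i)%N & (h i <= m)%N).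
    by apply: IHm; exists j.
  exists i; split=> // j leNj; apply: leq_trans him _; rewrite ltnNge.
  by apply/negP=> hjm; apply: nex; exists j.
pose nx N := sval (constructive_indefinite_description _ (next N)).
have nxP N : (N <= nx N)%N /\ forall j, (N <= j)%N -> (h (nx N) <= h j)%N.
  exact: svalP (constructive_indefinite_description _ (next N)).
pose phi := fix phi n := nx (if n is n'.+1 then (phi n').+1 else 0)%N.
have phi_lt : {homo phi : i j / (i < j)%N}.
  apply: homo_ltn => [x y z|n]; first exact: ltn_trans.
  exact: (nxP (phi n).+1).1.
exists phi; split=> // i j; rewrite leq_eqVlt => /predU1P[-> //|ltij] /=.
case: i ltij => [|i] ltij; apply: (nxP _).2 => //.
by apply: phi_lt; apply: ltnW.
Qed.

(** Passing to a subsequence for each coordinate in turn makes all exponents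
    nondecreasing. *)
Lemma dickson k (m : nat -> 'X_{1..k}) :
  exists i j, (i < j)%N /\ (m i <= m j)%MM.
Proof.
suff [phi [phi_lt mphi]] : exists phi : nat -> nat,
    {homo phi : i j / (i < j)%N} /\
    forall c, c \in enum 'I_k -> {homo (fun i => m (phi i) c) : i j / (i <= j)%N}.
  exists (phi 0%N), (phi 1%N); split; first exact: phi_lt.
  by apply/mnm_lepP => c; apply: mphi; rewrite ?mem_enum.
elim: (enum 'I_k) => [|c s [phi [phi_lt mphi]]]; first by exists id; split.
have [psi [psi_lt mpsi]] := nondecreasing_subseq (fun i => m (phi i) c).
have psi_le : {homo psi : i j / (i <= j)%N} by apply: ltn_homo_leq || exact: ltnW_homo.
exists (phi \o psi); split=> [i j /psi_lt/phi_lt // | c'].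
by rewrite inE => /predU1P[-> // | /mphi mc'] i j /psi_le /mc'.
Qed.

(** If an ideal Q were not finitely generated, one could choose in it elements g 0,
    g 1, ... such that g n has the least leading monomial among the elements of Q not
    generated by the earlier ones.  By Dickson's lemma some leading monomial divides
    a later one, and cancelling the leading term contradicts minimality. *)
Theorem mpoly_noetherian (K : fieldType) (k : nat) : noetherian {mpoly K[k]}.
Proof.
move=> f; apply: NNPP => nfg.
pose below N g := exists2 i, (i < N)%N & g = f i.
pose Q g := exists N, ideal_gen (below N) g.
pose gen (s : seq {mpoly K[k]}) := ideal_gen (fun g => g \in s).
have belowS N M : (N <= M)%N ->
    forall g, ideal_gen (below N) g -> ideal_gen (below M) g.
  move=> leNM g; apply: ideal_genS => _ [i ltiN ->].
  by exists i => //; apply: leq_trans leNM.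
have idQ : is_ideal Q.
  split=> [|a b [N Na] [M Mb] | r a [N Na]].
  - by exists 0%N; case: (ideal_gen_ideal (below 0%N)).
  - exists (maxn N M); case: (ideal_gen_ideal (below (maxn N M))) => _ ID _.
    by apply: ID; [apply: belowS Na | apply: belowS Mb]; rewrite ?leq_maxl ?leq_maxr.
  - by exists N; case: (ideal_gen_ideal (below N)) => _ _; apply.
have next (s : seq {mpoly K[k]}) : (forall g, g \in s -> Q g) ->
    exists g, [/\ Q g, ~ gen s g &
      forall h, Q h -> ~ gen s h -> (mlead g <= mlead h)%O].
  move=> sQ; have [N sN] : exists N, forall g, g \in s -> ideal_gen (below N) g.
    elim: s sQ => [|a s IHs] sQ; first by exists 0%N.
    have [g sg|N sN] := IHs; first by apply: sQ; rewrite inE sg orbT.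
    have [M Ma] := sQ a (mem_head _ _); exists (maxn N M) => g.
    rewrite inE => /predU1P[-> | /sN].
      by apply: belowS Ma; rewrite leq_maxr.
    by apply: belowS; rewrite leq_maxl.
  have ngenf : ~ gen s (f N).
    move=> sfN; apply: nfg; exists N; apply: sfN; first exact: ideal_gen_ideal.
    by move=> g /sN.
  have QfN : Q (f N) by exists N.+1; apply: ideal_gen_mem; exists N.
  move Dm: (mlead (f N)) => m.
  elim/(well_founded_ind (@ltom_wf k)): m (f N) Dm QfN ngenf => m IHm h Dm Qh nh.
  have [[h' [Qh' nh' lth']] | nex] := classic (exists h',
      [/\ Q h', ~ gen s h' & (mlead h' < mlead h)%O]).
    by apply: IHm (erefl _) Qh' nh'; rewrite -Dm.
  exists h; split=> // h' Qh' nh'; rewrite leNgt.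
  by apply/negP=> lth'; apply: nex; exists h'.
pose P (s : seq {mpoly K[k]}) := forall g, g \in s -> Q g.
have nextP (s : {s | P s}) : exists t : {s | P s}, exists g,
    [/\ sval t = rcons (sval s) g, ~ gen (sval s) g &
        forall h, Q h -> ~ gen (sval s) h -> (mlead g <= mlead h)%O].
  case: s => s Ps; have [g [Qg ng ming]] := next s Ps.
  have Pt : P (rcons s g).
    by move=> h; rewrite mem_rcons inE => /predU1P[-> // | /Ps].
  by exists (exist _ _ Pt), g.
have P0 : P [::] by [].
pose nx s := sval (constructive_indefinite_description _ (nextP s)).
pose S := fix S n := if n is n'.+1 then nx (S n') else exist _ _ P0.
have /(_ _)/constructive_indefinite_description SP n : exists g,
    [/\ sval (S n.+1) = rcons (sval (S n)) g, ~ gen (sval (S n)) g &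
        forall h, Q h -> ~ gen (sval (S n)) h -> (mlead g <= mlead h)%O].
  exact: svalP (constructive_indefinite_description _ (nextP (S n))).
pose g n := sval (SP n).
have memS i j : (i < j)%N -> g i \in sval (S j).
  elim: j => // j IHj; rewrite ltnS leq_eqVlt.
  have [E _ _] := svalP (SP j); rewrite E.
  by rewrite mem_rcons inE => /predU1P[-> | /IHj ->]; rewrite ?eqxx ?orbT.
have [i [j [ltij dvd_ij]]] := dickson (fun n => mlead (g n)).
have [_ ngj minj] := svalP (SP j); rewrite -/(g j) /= in ngj minj dvd_ij.
have Sgi := memS _ _ ltij; have Qgi := svalP (S j) _ Sgi.
have Qgj : Q (g j) := svalP (S j.+1) _ (memS _ _ (ltnSn j)).
have nz_gen n h : ~ gen (sval (S n)) h -> h != 0.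
  move=> nh; apply/eqP=> h0; apply: nh; rewrite h0.
  by case: (ideal_gen_ideal (fun g => g \in sval (S n))).
have nz_gi : g i != 0 by apply: (nz_gen i); case: (svalP (SP i)).
pose q : {mpoly K[k]} := (mleadc (g j) / mleadc (g i)) *: 'X_[mlead (g j) - mlead (g i)].
pose h := g j - q * g i.
have Qh : Q h by apply: ideal_sub Qgj _ => //; case: idQ => _ _; apply.
have nh : ~ gen (sval (S j)) h.
  move=> genh; apply: ngj; rewrite -[g j](subrK (q * g i)) -/h.
  case: (ideal_gen_ideal (fun g => g \in sval (S j))) => _ ID IM.
  by apply: ID => //; apply: IM; apply: ideal_gen_mem.
have lead_h : h@_(mlead (g j)) = 0.
  have := mcoeffMX (g i) (mlead (g j) - mlead (g i)) (mlead (g i)).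
  rewrite submK // mulrC => qE; rewrite mcoeffB -scalerAl mcoeffZ qE divfK ?subrr //.
  by rewrite mleadc_eq0.
have nz_h := nz_gen _ _ nh.
have lt_h : (mlead h < mlead (g j))%O.
  rewrite lt_neqAle; apply/andP; split.
    by apply/eqP=> E; move/eqP: lead_h; rewrite -E mleadc_eq0 (negPf nz_h).
  apply: le_trans (mleadB_le _ _) _.
  rewrite leUx lexx /=.
  apply: le_trans (mleadM_le _ _) _.
  rewrite -[leRHS](submK dvd_ij) lemc_add2l.
  by apply: le_trans (mleadZ_le _ _) _; rewrite mleadXm.
by have := minj h Qh nh; rewrite leNgt lt_h.
Qed.

(** * Prime chains above the annihilator of an element *)

Section PrimeChains.
Variable R : comNzRingType.
Implicit Types (I J P Q m : R -> Prop).

(** The annihilator of the class of b in R / I. *)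
Definition colon I b : R -> Prop := fun f => I (f * b).

Lemma colon_ideal I b : is_ideal I -> is_ideal (colon I b).
Proof.
case=> I0 ID IM; split=> [|f g|r f]; rewrite /colon ?mul0r //.
  by rewrite mulrDl; apply: ID.
by rewrite -mulrA; apply: IM.
Qed.

Lemma has_prime_chain_mono I J d :
  (forall f, I f -> J f) -> has_prime_chain J d -> has_prime_chain I d.
Proof.
move=> sIJ [P [primeP incP]]; exists P; split=> // i /primeP[? sJP].
by split=> // f /sIJ/sJP.
Qed.

Lemma has_prime_chain0 I P :
  is_prime_ideal P -> (forall f, I f -> P f) -> has_prime_chain I 0.
Proof. by move=> primeP sIP; exists (fun=> P). Qed.

Lemma has_prime_chain_cons I J P d :
    is_prime_ideal P -> (forall f, I f -> P f) -> (forall f, P f -> J f) ->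
    ~ (forall f, J f -> P f) ->
  has_prime_chain J d -> has_prime_chain I d.+1.
Proof.
move=> primeP sIP sPJ nJP [Q [primeQ incQ]].
exists (fun i => if i is i'.+1 then Q i' else P); split=> [[|i] lei|[|i] lti].
- by split.
- have [? sJQ] := primeQ i lei; split=> // f /sIP/sPJ; exact: sJQ.
- have [_ sJQ] := primeQ 0%N (leq0n _); split=> [f /sPJ|sQP]; first exact: sJQ.
  by apply: nJP => f /sJQ/sQP.
- exact: incQ.
Qed.

(** An associated prime in the localization at m: a colon ideal which is maximal
    among those that contain the given one and lie in m.  Were u * v in it with
    neither factor in it, multiplying c by v, or by some w outside m with w * v in it,
    would enlarge it. *)
Lemma ex_prime_colon J m b :
    noetherian R -> is_ideal J -> is_prime_ideal m -> (forall f, colon J b f -> m f) ->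
  exists c, [/\ is_prime_ideal (colon J c), forall f, colon J c f -> m f
              & forall f, colon J b f -> colon J c f].
Proof.
move=> noeR idJ [idm nm1 mprime] Jbm.
pose C I := exists c, [/\ I = colon J c, forall f, colon J b f -> colon J c f
  & forall f, colon J c f -> m f].
have [|| _ [c [-> Jbc Jcm]] maxc] := @noetherian_max R C noeR.
- by move=> _ [c [-> _ _]]; apply: colon_ideal.
- by exists (colon J b), b.
exists c; split=> //; split=> [||u v Juv]; first exact: colon_ideal.
  by move/Jcm.
have [Jv | nJv] := classic (colon J c v); [by right | left].
have JM r f : J f -> J (r * f) by case: idJ => _ _; apply.
have Jcvc r f : colon J c f -> colon J (r * c) f.
  by rewrite /colon mulrCA; apply: JM.
(* Either (J : v * c) still lies in m, or some w outside m multiplies v * c into J. *)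
have [vc_m | /not_all_ex_not[w nvc_m]] := classic (forall f, colon J (v * c) f -> m f).
  apply: (maxc (colon J (v * c))) => [|f|]; last by rewrite /colon mulrA.
    by exists (v * c); split=> // f /Jbc; apply: Jcvc.
  exact: Jcvc.
have [Jwvc nmw] := imply_to_and _ _ nvc_m.
case: nJv; apply: (maxc (colon J (w * c))) => [|f|].
- exists (w * c); split=> // [f /Jbc|f]; first exact: Jcvc.
  by rewrite /colon mulrA => /Jcm/mprime[].
- exact: Jcvc.
- by rewrite /colon mulrCA.
Qed.

(** Here Q' is Q + (x).  The elements b with (Q : a) in (Q : b) form an ideal in which
    one may divide by x modulo Q.  If none of them survived in the localization of
    R / Q' at m, then a would be divisible by all powers of x in the localization of
    R / Q; an ascending chain argument as for Krull's intersection theorem makes a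
    vanish there. *)
Lemma colon_descend m Q Q' x a :
    noetherian R -> is_prime_ideal m -> is_ideal Q ->
    (forall f, Q' f <-> exists r, Q (f - x * r)) -> m x ->
    (forall g, Q (x * g) -> Q g) -> (forall f, colon Q a f -> m f) ->
  exists b, (forall f, colon Q' b f -> m f) /\ forall f, colon Q a f -> colon Q b f.
Proof.
move=> noeR [idm nm1 mprime] idQ Q'E mx xreg Qam; apply: NNPP => nob.
pose N b := forall f, colon Q a f -> colon Q b f.
have QM r f : Q f -> Q (r * f) by case: idQ => _ _; apply.
have QD f g : Q f -> Q g -> Q (f + g) by case: idQ => _ + _; apply.
have mM r f : m f -> m (r * f) by case: idm => _ _; apply.
have mMn f g : ~ m f -> ~ m g -> ~ m (f * g) by move=> nf ng /mprime[].
have next (b : {b | N b}) : exists c : {b | N b}, exists u,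
    ~ m u /\ Q (u * sval b - x * sval c).
  case: b => b Nb; have [u nu] : exists u, ~ (colon Q' b u -> m u).
    by apply: not_all_ex_not => Q'bm; apply: nob; exists b.
  have [/Q'E[r Qr] nmu] := imply_to_and _ _ nu.
  have Nr : N r.
    move=> f Qf; apply: xreg.
    have -> : x * (f * r) = u * (f * b) - f * (u * b - x * r) by ring.
    by apply: ideal_sub => //; apply: QM => //; apply: Nb.
  by exists (exist _ _ Nr), u.
have Na : N a by [].
pose nx b := sval (constructive_indefinite_description _ (next b)).
pose B := fix B n := if n is n'.+1 then nx (B n') else exist _ a Na.
pose b n := sval (B n).
have step n : exists u, ~ m u /\ Q (u * b n - x * b n.+1).
  exact: svalP (constructive_indefinite_description _ (next (B n))).
have steps i d : exists u, ~ m u /\ Q (u * b i - x ^+ d * b (i + d)%N).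
  elim: d => [|d [u [nmu Qu]]].
    by exists 1; rewrite addn0 expr0 subrr; split=> //; case: idQ.
  have [v [nmv Qv]] := step (i + d)%N; exists (v * u); split; first exact: mMn.
  rewrite addnS; have -> : v * u * b i - x ^+ d.+1 * b (i + d).+1 =
      v * (u * b i - x ^+ d * b (i + d)%N) + x ^+ d * (v * b (i + d)%N - x * b (i + d).+1).
    by rewrite exprS; ring.
  by apply: QD; apply: QM.
(* The elements that are multiples of x * b j in the localization of R / Q form an ideal
   which contains the earlier terms, hence also b j itself for a suitable j. *)
have [j /(_ (fun f => exists u r, ~ m u /\ Q (u * f - x * r * b j)))[||u [r [nmu Qu]]]] :=
  noeR b.
- split=> [|f g [u [r [nmu Qu]]] [v [s [nmv Qv]]]|t f [u [r [nmu Qu]]]].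
  + by exists 1, 0; rewrite !(mulr0, mul0r) subr0; split=> //; case: idQ.
  + exists (v * u), (v * r + u * s); split; first exact: mMn.
    have -> : v * u * (f + g) - x * (v * r + u * s) * b j =
      v * (u * f - x * r * b j) + u * (v * g - x * s * b j) by ring.
    by apply: QD; apply: QM.
  + exists u, (t * r); split=> //.
    have -> : u * (t * f) - x * (t * r) * b j = t * (u * f - x * r * b j) by ring.
    exact: QM.
- move=> _ [i ltij ->]; have [u [nmu]] := steps i (j - i.+1).+1.
  rewrite subnSK // subnKC ?(ltnW ltij) // => Qu.
  by exists u, (x ^+ (j - i.+1)); rewrite -exprS subnSK.
have [v [nmv Qv]] := steps 0%N j; rewrite add0n in Qv.
have nmur : ~ m (u - x * r).
  by move=> mur; apply: nmu; rewrite -(subrK (x * r) u); case: (idm) => _ mD _;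
    apply: mD => //; rewrite mulrC; apply: mM.
apply: (mMn _ _ nmur nmv); apply: Qam; rewrite /colon.
have -> : (u - x * r) * v * a =
  (u - x * r) * (v * b 0%N - x ^+ j * b j) + x ^+ j * (u * b j - x * r * b j).
  by rewrite /b /=; ring.
by apply: QD; apply: QM.
Qed.

(** Locally at m, depth is at most the dimension of any cyclic submodule: a prime of the
    form (Q 0 : c) inside m does not contain x 0, while by colon_descend it lies, together with
    x 0, in a colon ideal of Q 1 = Q 0 + (x 0), to which the argument applies again. *)
Lemma colon_prime_chain m (Q : nat -> R -> Prop) (x : nat -> R) e b :
    noetherian R -> is_prime_ideal m -> (forall i, is_ideal (Q i)) ->
    (forall i, (i < e)%N -> [/\ forall f, Q i.+1 f <-> exists r, Q i (f - x i * r),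
      m (x i) & forall g, Q i (x i * g) -> Q i g]) ->
    (forall f, colon (Q 0%N) b f -> m f) ->
  has_prime_chain (colon (Q 0%N) b) e.
Proof.
move=> noeR primem idQ regQ; elim: e Q x b idQ regQ => [|e IHe] Q x b idQ regQ Qbm.
  exact: has_prime_chain0 primem Qbm.
have [Q1E mx xreg] := regQ 0%N (ltn0Sn e).
have [c [primec Qcm Qbc]] := ex_prime_colon noeR (idQ 0%N) primem Qbm.
have [a [Qam Qca]] := colon_descend noeR primem (idQ 0%N) Q1E mx xreg Qcm.
have chain1 : has_prime_chain (colon (Q 1%N) a) e.
  apply: (IHe (fun i => Q i.+1) (fun i => x i.+1)) => // i lti.
  exact: (regQ i.+1 lti).
apply: (has_prime_chain_cons primec Qbc _ _ chain1).
  by move=> f /Qca Qfa; apply/Q1E; exists 0; rewrite mulr0 subr0.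
have xa : colon (Q 1%N) a (x 0%N).
  by apply/Q1E; exists a; rewrite subrr; case: (idQ 0%N).
by move=> /(_ _ xa)/xreg; case: primec => _ nc1 _; rewrite -[c]mul1r.
Qed.

Lemma ideal_adjoin_nil I f : is_ideal I -> ideal_adjoin I [::] f <-> I f.
Proof.
by move=> idI; split=> [/(_ I idI)|If]; [apply=> g [] | apply: ideal_gen_mem; left].
Qed.

Lemma ideal_adjoin_rcons I s x f :
  ideal_adjoin I (rcons s x) f <-> exists r, ideal_adjoin I s (f - x * r).
Proof.
have [s0 sD sM] := ideal_gen_ideal (fun f => I f \/ f \in s).
have [t0 tD tM] := ideal_gen_ideal (fun f => I f \/ f \in rcons s x).
split=> [/(_ (fun f => exists r, ideal_adjoin I s (f - x * r)))|[r Ir]].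
  apply=> [|g]; last first.
    rewrite mem_rcons inE => -[Ig|/predU1P[->|sg]].
    - by exists 0; rewrite mulr0 subr0; apply: ideal_gen_mem; left.
    - by exists 1; rewrite mulr1 subrr.
    - by exists 0; rewrite mulr0 subr0; apply: ideal_gen_mem; right.
  split=> [|a b [u Ia] [v Ib]|r a [u Ia]].
  - by exists 0; rewrite mulr0 subr0.
  - exists (u + v); have -> : a + b - x * (u + v) = a - x * u + (b - x * v) by ring.
    exact: sD.
  - exists (r * u); have -> : r * a - x * (r * u) = r * (a - x * u) by ring.
    exact: sM.
rewrite -(subrK (x * r) f); apply: tD.
  apply: ideal_genS Ir => g [Ig|sg]; [by left | right].
  by rewrite mem_rcons inE sg orbT.
by rewrite mulrC; apply: tM; apply: ideal_gen_mem; right; rewrite mem_rcons mem_head.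
Qed.

Lemma regular_sequence_chain m I s b :
    noetherian R -> is_prime_ideal m -> is_ideal I ->
    (forall f, f \in s -> m f) -> regular_sequence_quot I s ->
    (forall f, colon I b f -> m f) ->
  has_prime_chain (colon I b) (size s).
Proof.
move=> noeR primem idI ms [regs _] Ibm.
have adj0 f : ideal_adjoin I (take 0 s) f <-> I f.
  by rewrite take0; apply: ideal_adjoin_nil.
apply: (@has_prime_chain_mono _ (colon (ideal_adjoin I (take 0 s)) b)) => [f /adj0 //|].
apply: (@colon_prime_chain m (fun i => ideal_adjoin I (take i s)) (fun i => s`_i)) => //.
- by move=> i; apply: ideal_gen_ideal.
- move=> i lti; split; [|by apply: ms; apply: mem_nth|exact: regs].
  by move=> f; rewrite (take_nth 0 lti); apply: ideal_adjoin_rcons.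
- by move=> f /adj0; apply: Ibm.
Qed.

End PrimeChains.

(** * Linear forms and the prime ideals that they generate *)

Section LinearForms.
Variables (K : fieldType) (k : nat).
Implicit Types (v : 'rV[K]_k) (f : {mpoly K[k]}).

Definition lform v : {mpoly K[k]} := \sum_j v 0 j *: 'X_j.

Lemma lform_is_linear : linear lform.
Proof.
move=> a v w; rewrite scaler_sumr -big_split /=; apply: eq_bigr => j _.
by rewrite !mxE scalerDl scalerA.
Qed.
HB.instance Definition _ :=
  GRing.isLinear.Build K 'rV[K]_k {mpoly K[k]} _ lform lform_is_linear.

Lemma mcoeff_lform v j : (lform v)@_U_(j) = v 0 j.
Proof.
rewrite raddf_sum (bigD1 j) //= mcoeffZ mcoeffXU eqxx mulr1 big1 ?addr0 // => i nij.
by rewrite mcoeffZ mcoeffXU (negPf nij) mulr0.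
Qed.

Lemma lform_delta j : lform (delta_mx 0 j) = 'X_j.
Proof.
rewrite /lform (bigD1 j) //= mxE !eqxx scale1r big1 ?addr0 // => i nij.
by rewrite mxE eqxx (negPf nij) scale0r.
Qed.

Definition lform_coord f : 'rV[K]_k := \row_j f@_U_(j).

Lemma lform_coordK f : f \is 1.-homog -> lform (lform_coord f) = f.
Proof.
move=> homf; apply/mpolyP => m.
have [/eqP/mdeg1P[j /eqP ->] | ndm] := eqVneq (mdeg m) 1%N.
  by rewrite mcoeff_lform mxE.
rewrite (dhomog_nemf_coeff homf ndm) raddf_sum big1 //= => j _.
rewrite mcoeffZ mcoeffX; case: eqP => [Dm | _]; last by rewrite mulr0.
by rewrite -Dm mdeg1 in ndm.
Qed.

Lemma lform_inj : injective lform.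
Proof. by move=> v w vw; apply/rowP => j; rewrite -!mcoeff_lform vw. Qed.

Lemma mpoly_ring_ind (P : {mpoly K[k]} -> Prop) :
    (forall c, P c%:MP) -> (forall j, P 'X_j) ->
    (forall f g, P f -> P g -> P (f + g)) -> (forall f g, P f -> P g -> P (f * g)) ->
  forall f, P f.
Proof.
move=> PC PX PD PM f; rewrite [f]mpolyE.
apply: (big_ind P) => [||m _]; [by rewrite -mpolyC0 | by [] |].
rewrite -mul_mpolyC; apply: (PM) => //; rewrite mpolyXE_id.
apply: (big_ind P) => [||j _]; [by rewrite -mpolyC1 | by [] |].
elim: (m j) => [|d IHd]; first by rewrite expr0 -mpolyC1.
by rewrite exprS; apply: (PM).
Qed.

End LinearForms.

Section LinearSubstitution.
Variable K : fieldType.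

(** The algebra morphism extending a linear map between the spaces of linear forms. *)
Definition lin_subst k e (A : 'Hom('rV[K]_k, 'rV[K]_e)) : {mpoly K[k]} -> {mpoly K[e]} :=
  comp_mpoly [tuple lform (A (delta_mx 0 j)) | j < k].
HB.instance Definition _ k e A := GRing.RMorphism.on (@lin_subst k e A).
HB.instance Definition _ k e A := GRing.Linear.on (@lin_subst k e A).

Lemma lin_substX k e (A : 'Hom('rV[K]_k, 'rV[K]_e)) j :
  lin_subst A 'X_j = lform (A (delta_mx 0 j)).
Proof. by rewrite /lin_subst comp_mpolyXU -tnth_nth tnth_mktuple. Qed.

Lemma lin_subst_lform k e (A : 'Hom('rV[K]_k, 'rV[K]_e)) v :
  lin_subst A (lform v) = lform (A v).
Proof.
rewrite {1}/lform linear_sum [in RHS](row_sum_delta v) !linear_sum /=.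
by apply: eq_bigr => j _; rewrite !linearZ /= lin_substX.
Qed.

Lemma lin_subst_comp k e r (A : 'Hom('rV[K]_k, 'rV[K]_e)) (B : 'Hom('rV_e, 'rV_r)) f :
  lin_subst B (lin_subst A f) = lin_subst (B \o A)%VF f.
Proof.
elim/mpoly_ring_ind: f => [c|j|f g IHf IHg|f g IHf IHg].
- by rewrite /lin_subst !comp_mpolyC.
- by rewrite -lform_delta !lin_subst_lform comp_lfunE.
- by rewrite !rmorphD /= IHf IHg.
- by rewrite !rmorphM /= IHf IHg.
Qed.

End LinearSubstitution.

Section LinearIdeals.
Variables (K : fieldType) (k : nat).
Implicit Types (v w : 'rV[K]_k) (U V : {vspace 'rV[K]_k}) (f g : {mpoly K[k]}).

(** The ideal generated by the forms of U, described as the kernel of the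
    substitution along a projection with kernel U, so that its primality and the
    membership of a form in it are immediate. *)
Definition linear_ideal U f : Prop := lin_subst (\1 - projv U)%VF f = 0.

Lemma linear_ideal_prime U : is_prime_ideal (linear_ideal U).
Proof.
split=> [||f g]; rewrite /linear_ideal.
- split=> [|f g f0 g0|r f f0]; first exact: rmorph0.
    by rewrite rmorphD /= f0 g0 addr0.
  by rewrite rmorphM /= f0 mulr0.
- by rewrite rmorph1; apply/eqP; rewrite oner_eq0.
- by move=> /eqP; rewrite rmorphM mulf_eq0 /= => /orP[] /eqP; [left | right].
Qed.

Lemma linear_ideal_ideal U : is_ideal (linear_ideal U).
Proof. by case: (linear_ideal_prime U). Qed.

Lemma linear_ideal_lform U v : linear_ideal U (lform v) <-> v \in U.
Proof.
rewrite /linear_ideal lin_subst_lform; rewrite add_lfunE opp_lfunE id_lfunE.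
split=> [/eqP | Uv]; last by rewrite projv_id // subrr linear0.
rewrite -(linear0 (@lform K k)) (inj_eq (@lform_inj K k)) subr_eq0 => /eqP ->.
exact: memv_proj.
Qed.

(** The substitution moves each variable by a form of U. *)
Lemma linear_ideal_min U (I : {mpoly K[k]} -> Prop) f :
    is_ideal I -> (forall u, u \in U -> I (lform u)) -> linear_ideal U f -> I f.
Proof.
move=> idI IU Uf; suff: I (f - lin_subst (\1 - projv U)%VF f) by rewrite Uf subr0.
case: (idI) => I0 ID IM {Uf}.
elim/mpoly_ring_ind: f => [c|j|f g IHf IHg|f g IHf IHg].
- by rewrite [lin_subst _ _]comp_mpolyC subrr.
- rewrite -lform_delta lin_subst_lform -linearB /= add_lfunE opp_lfunE id_lfunE subKr.
  exact/IU/memv_proj.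
- by rewrite rmorphD /= opprD addrACA; apply: ID.
- rewrite rmorphM /=; set f' := lin_subst _ f in IHf *; set g' := lin_subst _ g in IHg *.
  have -> : f * g - f' * g' = f * (g - g') + g' * (f - f') by ring.
  by apply: ID; apply: IM.
Qed.

Lemma linear_ideal_mono U V f : (U <= V)%VS -> linear_ideal U f -> linear_ideal V f.
Proof.
move=> /subvP sUV; apply: linear_ideal_min (linear_ideal_ideal V) _ => u /sUV Vu.
exact/linear_ideal_lform.
Qed.

Lemma linear_ideal_add U v f :
  linear_ideal (<[v]> + U) f -> exists h, linear_ideal U (f - lform v * h).
Proof.
have [U0 UD UM] := linear_ideal_ideal U.
apply: (@linear_ideal_min _ (fun f => exists h, linear_ideal U (f - lform v * h)))
  => [|_ /memv_addP[_ /vlineP[c ->] [u Uu ->]]].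
  split=> [|f1 f2 [h1 Uh1] [h2 Uh2] | r f1 [h1 Uh1]].
  - by exists 0; rewrite mulr0 subr0.
  - exists (h1 + h2); have -> : f1 + f2 - lform v * (h1 + h2) =
      f1 - lform v * h1 + (f2 - lform v * h2) by ring.
    exact: UD.
  - exists (r * h1); have -> : r * f1 - lform v * (r * h1) = r * (f1 - lform v * h1) by ring.
    exact: UM.
exists c%:MP; rewrite linearD linearZ /= mulrC mul_mpolyC addrC addKr.
exact/linear_ideal_lform.
Qed.

Lemma linear_ideal0 f : linear_ideal 0%VS f <-> f = 0.
Proof.
split=> [|->]; last exact: rmorph0.
apply: (@linear_ideal_min _ (fun f => f = 0)) => [|u].
  by split=> [|a b -> ->|r a ->]; rewrite ?addr0 ?mulr0.
by rewrite memv0 => /eqP ->; rewrite linear0.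
Qed.

Lemma irrelevant_idealE f : irrelevant_ideal K k f <-> linear_ideal fullv f.
Proof.
split; last first.
  apply: linear_ideal_min => [|u _]; first exact: ideal_gen_ideal.
  apply: ideal_sum; first exact: ideal_gen_ideal.
  move=> j _; rewrite -mul_mpolyC.
  case: (ideal_gen_ideal (fun f : {mpoly K[k]} => exists j, f = 'X_j)) => _ _.
  by apply; apply: ideal_gen_mem; exists j.
apply; first exact: linear_ideal_ideal.
by move=> _ [j ->]; rewrite -lform_delta; apply/linear_ideal_lform/memvf.
Qed.

Lemma irrelevant_ideal_prime : is_prime_ideal (irrelevant_ideal K k).
Proof.
have [[m0 mD mM] nm1 mprime] := linear_ideal_prime fullv.
split=> [||f g /irrelevant_idealE/mprime[]/irrelevant_idealE].
- exact: ideal_gen_ideal.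
- by move/irrelevant_idealE.
- by left.
- by right.
Qed.

End LinearIdeals.

Arguments irrelevant_ideal_prime : clear implicits.

(** * Upper bound on the length of a chain of primes *)

Lemma prime_ideal_expM (R : comNzRingType) (P : R -> Prop) x n y :
  is_prime_ideal P -> ~ P x -> P (x ^+ n * y) -> P y.
Proof.
move=> [_ _ mulP] nPx; elim: n => [|n IHn]; first by rewrite mul1r.
by rewrite exprS -mulrA => /mulP[|/IHn].
Qed.

Lemma ex_left_kernel (K : fieldType) (S T : finType) (F : S -> T -> K) :
  (#|T| < #|S|)%N ->
  exists2 v : S -> K, exists a, v a != 0 & forall b, \sum_a v a * F a b = 0.
Proof.
move=> ltTS; pose A := \matrix_(i < #|S|, j < #|T|) F (enum_val i) (enum_val j).
have /rowV0Pn[v /sub_kermxP vA nzv] : kermx A != 0.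
  by rewrite -mxrank_eq0 mxrank_ker subn_eq0 -ltnNge; apply: leq_ltn_trans (rank_leq_col A) _.
have /rV0Pn[i nzvi] := nzv.
exists (fun a => v 0 (enum_rank a)) => [|b]; first by exists (enum_val i); rewrite enum_valK.
have /rowP/(_ (enum_rank b)) := vA; rewrite !mxE => {2}<-.
rewrite (reindex (fun i : 'I_#|S| => enum_val i)) /=; last by apply: onW_bij; apply: enum_val_bij.
by apply: eq_bigr => j _; rewrite !mxE enum_valK enum_rankK.
Qed.

Lemma msizeM_leS (K : fieldType) k (f g : {mpoly K[k]}) a b :
  (msize f <= a.+1)%N -> (msize g <= b.+1)%N -> (msize (f * g) <= (a + b).+1)%N.
Proof.
move=> lef leg; have [->|nzf] := eqVneq f 0; first by rewrite mul0r msize0.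
have [->|nzg] := eqVneq g 0; first by rewrite mulr0 msize0.
by rewrite msizeM // -ltnS prednK ?addn_gt0 ?lt0n ?msize_poly_eq0 ?nzf // -addSn -addnS leq_add.
Qed.

(** The number of monomials of bounded exponents in d polynomials outgrows the
    dimension of the space of polynomials in e < d variables to which they belong. *)
Lemma algebraic_relation (K : fieldType) e d (q : 'I_d -> {mpoly K[e]}) :
    (e < d)%N ->
  exists N (v : {ffun 'I_d -> 'I_N} -> K), (exists a, v a != 0) /\
    \sum_a v a *: \prod_j q j ^+ a j = 0.
Proof.
move=> lted; pose D := \max_j msize (q j).
(* With N ^ d > M ^ e there are more monomials with exponents below N in the q j than
   monomials in e variables with exponents below M, and M bounds the degrees. *)
pose N := ((d * D).+1 ^ e).+1; pose M := (d * (D * N)).+1.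
have sizeX j n : (msize (q j ^+ n) <= (D * n).+1)%N.
  elim: n => [|n IHn]; first by rewrite muln0 expr0 msize1.
  by rewrite exprS mulnS; apply: msizeM_leS => //; apply/leqW/leq_bigmax.
have size_prod (a : {ffun 'I_d -> 'I_N}) : (msize (\prod_j q j ^+ a j) <= M)%N.
  have le_prod : (msize (\prod_j q j ^+ a j) <= (\sum_(j < d) D * N).+1)%N.
    apply: (big_ind2 (fun f s => msize f <= s.+1)%N) => [||j _].
    - by rewrite msize1.
    - by move=> f s g t; apply: msizeM_leS.
    - by apply: leq_trans (sizeX _ _) _; rewrite ltnS leq_mul2l ltnW ?orbT.
  by apply: leq_trans le_prod _; rewrite sum_nat_const card_ord.
pose mon (b : {ffun 'I_e -> 'I_M}) : 'X_{1..e} := [multinom (b i : nat) | i < e].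
have [|v nzv relv] := ex_left_kernel
  (fun (a : {ffun 'I_d -> 'I_N}) b => (\prod_j q j ^+ a j)@_(mon b)).
  rewrite !card_ffun !card_ord; apply: (@leq_trans (N ^ e.+1)); last first.
    by rewrite leq_exp2l // ltnS expn_gt0.
  apply: (@leq_ltn_trans (((d * D).+1 * N) ^ e)).
    have leMN : (M <= (d * D).+1 * N)%N by rewrite /M mulnA mulSn -add1n leq_add.
    suff leX s : (M ^ s <= ((d * D).+1 * N) ^ s)%N by [].
    by elim: s => // s IHs; rewrite !expnS leq_mul.
  by rewrite expnMn expnS ltn_pmul2r ?expn_gt0.
exists N, v; split=> //; apply/mpolyP => m; rewrite mcoeff0 raddf_sum /=.
have [/forallP ltm | ] := boolP [forall i, m i < M]%N.
  have -> : m = mon [ffun i => Ordinal (ltm i)] by apply/mnmP => i; rewrite mnmE ffunE.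
  rewrite -[RHS](relv [ffun i => Ordinal (ltm i)]).
  by apply: eq_bigr => a _; rewrite mcoeffZ.
rewrite negb_forall => /existsP[i]; rewrite -leqNgt => leMm.
apply: big1 => a _; rewrite mcoeffZ [_@_m]memN_msupp_eq0 ?mulr0 //.
apply: msize_mdeg_ge; apply: leq_trans (size_prod a) (leq_trans leMm _).
by rewrite mdegE (bigD1 i) //= leq_addr.
Qed.

(** Elements x i of P i.+1 outside P i have no algebraic relation modulo P 0:
    the terms of a relation with least exponent of x 0 give, after division by that
    power, a relation modulo P 1 between the other elements, and so on. *)
Lemma prime_chain_independent (K : fieldType) k d (P : nat -> {mpoly K[k]} -> Prop)
    (x : 'I_d -> {mpoly K[k]}) N (v : {ffun 'I_d -> 'I_N} -> K) :
    (forall i, (i <= d)%N -> is_prime_ideal (P i)) ->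
    (forall i, (i < d)%N -> forall f, P i f -> P i.+1 f) ->
    (forall i : 'I_d, P i.+1 (x i) /\ ~ P i (x i)) ->
    P 0%N (\sum_a v a *: \prod_j x j ^+ a j) ->
  forall a, v a = 0.
Proof.
move=> primeP incP xP relP a1; apply: NNPP => /eqP nzva1.
have peel i : (i <= d)%N -> exists S : {set {ffun 'I_d -> 'I_N}},
    [/\ exists a, a \in S, forall a, a \in S -> v a != 0,
        forall a b (j : 'I_d), a \in S -> b \in S -> (j < i)%N -> a j = b j
      & P i (\sum_(a in S) v a *: \prod_(j < d | (i <= j)%N) x j ^+ a j)].
  elim: i => [|i IHi] lei.
    exists [set a | v a != 0]; split=> [|a||]; rewrite ?inE //.
      by exists a1; rewrite inE.
    have -> // : \sum_(a in [set a | v a != 0]) v a *: \prod_(j < d | (0 <= j)%N) x j ^+ a j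
      = \sum_a v a *: \prod_j x j ^+ a j.
    rewrite big_mkcond /=; apply: eq_bigr => a _; rewrite inE.
    by case: eqP => //= ->; rewrite scale0r.
  have [S [[a0 Sa0] nzS eqS PS]] := IHi (ltnW lei).
  pose o := Ordinal lei; have [Pxo nPxo] := xP o.
  pose b := [arg min_(a < a0 in S) (a o : nat)].
  have [Sb minb] : b \in S /\ forall a, a \in S -> (b o <= a o)%N.
    by rewrite /b; case: arg_minnP.
  exists [set a in S | a o == b o]; split=> [|a|a c j|].
  - by exists b; rewrite inE Sb eqxx.
  - by rewrite inE => /andP[/nzS].
  - rewrite !inE => /andP[Sa /eqP ao] /andP[Sc /eqP co]; rewrite ltnS leq_eqVlt.
    case/predU1P=> [ji | ltji]; last exact: eqS.
    by have -> : j = o by [apply: val_inj]; rewrite ao co.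
  pose T (a : {ffun 'I_d -> 'I_N}) := x o ^+ (a o - b o) * \prod_(j < d | (i < j)%N) x j ^+ a j.
  have [idP _ _] := primeP _ lei.
  have PT : P i.+1 (\sum_(a in S) v a *: T a).
    apply: incP => //; apply: (prime_ideal_expM (primeP _ (ltnW lei)) nPxo (n := b o)).
    rewrite mulr_sumr; move: PS; congr (P i _); apply: eq_bigr => a Sa.
    rewrite -scalerAr; congr (_ *: _); rewrite /T mulrA -exprD subnKC ?minb //.
    rewrite (bigD1 o) //=; congr (_ * _); apply: eq_bigl => j.
    by rewrite ltn_neqAle andbC eq_sym.
  have -> : \sum_(a in [set a in S | a o == b o]) v a *: \prod_(j < d | (i < j)%N) x j ^+ a j =
      \sum_(a in S) v a *: T a - \sum_(a in S | a o != b o) v a *: T a.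
    rewrite [X in _ = X - _](bigID (fun a : {ffun _} => a o == b o)) /= addrK.
    rewrite [LHS](eq_bigl (fun a => (a \in S) && (a o == b o))) => [|a]; last by rewrite inE.
    by apply: eq_bigr => a /andP[_ /eqP ao]; rewrite /T ao subnn mul1r.
  apply: ideal_sub => //; apply: ideal_sum => // a /andP[Sa nao].
  rewrite scalerAl; apply: ideal_mulr => //.
  have lt_ab : (0 < a o - b o)%N by rewrite subn_gt0 ltn_neqAle minb // andbT eq_sym.
  rewrite -(prednK lt_ab) exprSr scalerAl.
  by case: idP => _ _; apply.
have [S [[a Sa] nzS eqS]] := peel d (leqnn d).
rewrite (big_pred1 a) => [|b]; last first.
  apply/idP/eqP => [Sb | -> //]; apply/ffunP => j; exact: eqS.
rewrite big_pred0 => [Pva|j]; last by rewrite leqNgt ltn_ord.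
have [[_ _ PM] nP1 _] := primeP d (leqnn d); apply: nP1.
have := PM (v a)^-1%:MP _ Pva; rewrite mul_mpolyC scalerA mulVf ?scale1r //.
exact: nzS.
Qed.

(** Modulo the forms of U a polynomial depends on k - dim U variables only. *)
Lemma proj_factor (K : fieldType) k (U : {vspace 'rV[K]_k}) :
  exists (A : 'Hom('rV[K]_k, 'rV[K]_(k - \dim U))) (B : 'Hom('rV_(k - \dim U), 'rV_k)),
    (B \o A)%VF = (\1 - projv U)%VF.
Proof.
have <- : \dim U^C = (k - \dim U)%N by rewrite dimv_compl dimvf /dim /= mul1n.
pose X := vbasis U^C; pose p := (\1 - projv U)%VF.
have linA : linear (fun v => \row_i coord X i (p v)).
  by move=> a v w; apply/rowP => i; rewrite !mxE linearP /= linearP.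
have linB : linear (fun r : 'rV[K]_(\dim U^C) => \sum_i r 0 i *: X`_i).
  move=> a v w; rewrite scaler_sumr -big_split /=; apply: eq_bigr => i _.
  by rewrite !mxE scalerDl scalerA.
pose fA := GRing.isLinear.Build _ _ _ _ _ linA; pose fB := GRing.isLinear.Build _ _ _ _ _ linB.
pose A : {linear _ -> _} := HB.pack (fun v => \row_i coord X i (p v)) fA.
pose B : {linear _ -> _} := HB.pack (fun r : 'rV[K]_(\dim U^C) => \sum_i r 0 i *: X`_i) fB.
exists (linfun A), (linfun B); apply/lfunP => v.
rewrite comp_lfunE !lfunE /= [RHS](@coord_vbasis _ _ _ U^C).
  by apply: eq_bigr => i _; rewrite mxE /p add_lfunE.
by rewrite opp_lfunE id_lfunE memv_projC.
Qed.

(** The elements x i of P i.+1 outside P i become, modulo the forms in the first prime,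
    polynomials in k - c variables, so that a chain longer than k - c would give a
    relation excluded by prime_chain_independent. *)
Lemma prime_chain_length (K : fieldType) k c (I : {mpoly K[k]} -> Prop) d :
    (forall P, is_prime_ideal P -> (forall f, I f -> P f) ->
       exists U : {vspace 'rV[K]_k}, \dim U = c /\ forall u, u \in U -> P (lform u)) ->
  has_prime_chain I d -> (d <= k - c)%N.
Proof.
move=> inU [P [primeP incP]].
have [U [<- PU]] := inU _ (primeP 0%N (leq0n _)).1 (primeP 0%N (leq0n _)).2.
rewrite leqNgt; apply/negP => lt_d.
have [A [B BA]] := proj_factor U.
have ex_x (i : 'I_d) : exists x, P i.+1 x /\ ~ P i x.
  apply: NNPP => nx; apply: (incP i (ltn_ord i)).2 => f Pf.
  by apply: NNPP => nPf; apply: nx; exists f.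
pose x i := sval (constructive_indefinite_description _ (ex_x i)).
have xP (i : 'I_d) : P i.+1 (x i) /\ ~ P i (x i).
  exact: svalP (constructive_indefinite_description _ (ex_x i)).
have [N [v [[a nzva] relv]]] := algebraic_relation (fun i => lin_subst A (x i)) lt_d.
suff va0 : v a = 0 by rewrite va0 eqxx in nzva.
apply: (@prime_chain_independent _ _ _ P x) => // [i /primeP[] // | i /incP[] //|].
have [[idP _ _] _] := primeP 0%N (leq0n _).
apply: (@linear_ideal_min _ _ U) => //.
rewrite /linear_ideal -BA -lin_subst_comp -[RHS](rmorph0 (lin_subst B)) -relv.
congr (lin_subst B _); rewrite rmorph_sum; apply: eq_bigr => a' _.
rewrite /= linearZ rmorph_prod /=; congr (_ *: _).
by apply: eq_bigr => j _; rewrite rmorphXn.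
Qed.

(** * Star configurations *)

Section StarIdeals.
Variables (K : fieldType) (k : nat).
Implicit Types (v w : 'rV[K]_k) (B C E : seq 'rV[K]_k) (U V : {vspace 'rV[K]_k}).
Implicit Types (f g h : {mpoly K[k]}) (P : {mpoly K[k]} -> Prop).

(** Let U be a space of linear forms.  This is the ideal generated by U and the
    products of size B + 1 - c members of B, the unit ideal if c exceeds size B: such
    a product either contains b or not.  When any c members of B are independent
    modulo U it defines the union of the linear spaces on which U and c members of B
    vanish, and c is its codimension in the space where U vanishes. *)
Fixpoint star_ideal U c B : {mpoly K[k]} -> Prop :=
  match c, B with
  | 0, _ => linear_ideal U
  | c'.+1, [::] => fun=> True
  | c'.+1, b :: B' => fun f => exists g h,
      [/\ star_ideal U c' B' g, star_ideal U c B' h & f = g + lform b * h]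
  end.

Lemma star_ideal0 U B : star_ideal U 0 B = linear_ideal U.
Proof. by case: B. Qed.

Lemma star_ideal_ideal U c B : is_ideal (star_ideal U c B).
Proof.
elim: B c => [|b B IHB] [|c]; do ?exact: linear_ideal_ideal; first by split.
have [I0 ID IM] := IHB c; have [J0 JD JM] := IHB c.+1.
split=> [|_ _ [g1 [h1 [Ig1 Jh1 ->]]] [g2 [h2 [Ig2 Jh2 ->]]]|r _ [g [h [Ig Jh ->]]]].
- by exists 0, 0; rewrite mulr0 addr0.
- exists (g1 + g2), (h1 + h2); split; [exact: ID | exact: JD | ring].
- exists (r * g), (r * h); split; [exact: IM | exact: JM | ring].
Qed.
Hint Resolve star_ideal_ideal : core.

Lemma star_ideal_consl U c b B f : star_ideal U c B f -> star_ideal U c.+1 (b :: B) f.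
Proof.
by move=> If; exists f, 0; rewrite mulr0 addr0; split=> //; case: (star_ideal_ideal U c.+1 B).
Qed.

Lemma star_ideal_consr U c b B f :
  star_ideal U c.+1 B f -> star_ideal U c.+1 (b :: B) (lform b * f).
Proof.
by move=> If; exists 0, f; rewrite add0r; split=> //; case: (star_ideal_ideal U c B).
Qed.

Lemma star_idealS U c B f : star_ideal U c B f -> star_ideal U c.+1 B f.
Proof.
elim: B c f => [|b B IHB] c f //.
case: c => [|c]; first by rewrite star_ideal0 -(star_ideal0 U B); apply: star_ideal_consl.
move=> [g [h [Ig Ih ->]]]; exists g, h; split=> //; exact: IHB.
Qed.

Lemma star_ideal_linear U c B f : linear_ideal U f -> star_ideal U c B f.
Proof. by move=> Uf; elim: c => [|c]; [rewrite star_ideal0 | apply: star_idealS]. Qed.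

Lemma star_ideal_mono U V c B f : (U <= V)%VS -> star_ideal U c B f -> star_ideal V c B f.
Proof.
move=> sUV; elim: B c f => [|b B IHB] [|c] f //=; do ?exact: linear_ideal_mono.
by move=> [g [h [Ig Ih ->]]]; exists g, h; split=> //; apply: IHB.
Qed.

Lemma star_ideal_add U v c B f :
  star_ideal (<[v]> + U) c B f -> exists h, star_ideal U c B (f - lform v * h).
Proof.
elim: B c f => [|b B IHB] [|c] f /=; do ?exact: linear_ideal_add; first by exists 0.
move=> [g [h [/IHB[g' Ig'] /IHB[h' Ih'] ->]]].
exists (g' + lform b * h'), (g - lform v * g'), (h - lform v * h').
by split=> //; ring.
Qed.

(** The generators that involve b die modulo b; the others generate the ideal of
    codimension c on B. *)
Lemma star_ideal_mod U c b B f :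
  star_ideal U c.+1 (b :: B) f -> star_ideal (<[b]> + U) c B f.
Proof.
move=> [g [h [Ig _ ->]]]; have [_ ID _] := star_ideal_ideal (<[b]> + U) c B.
apply: ID; first by apply: star_ideal_mono Ig; apply: addvSr.
apply: star_ideal_linear; apply: ideal_mulr; first exact: linear_ideal_ideal.
by apply/linear_ideal_lform; apply: subvP (addvSl _ _) _ (memv_line b).
Qed.

(** The induction proves along the way that b is a nonzerodivisor modulo the ideal of
    codimension c on B.  This gives the colon formula
    star_ideal c.+1 (b :: B) : b = star_ideal c.+1 B, which reduces the regularity of v
    on star_ideal c.+1 (b :: B) to its regularity modulo b, that is on an ideal of
    codimension c, and on star_ideal c.+1 B. *)
Lemma star_ideal_regular c E B v g :
    (forall C, subseq C B -> size C = c -> free (v :: C ++ E)) ->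
  star_ideal <<E>> c B (lform v * g) -> star_ideal <<E>> c B g.
Proof.
elim: B c E v g => [|b B IHB] [|c] E v g freeC //.
1,2: have := freeC [::] isT erefl; rewrite free_cons => /andP[nEv _].
1,2: have [_ _ Pp] := linear_ideal_prime <<E>> => /Pp[/linear_ideal_lform Ev|//].
1,2: by rewrite Ev in nEv.
(* Regularity modulo b writes g as b * h up to the ideal. *)
move=> Ivg; have /star_ideal_add[h Igh] : star_ideal (<[b]> + <<E>>) c B g.
  move/star_ideal_mod: Ivg; rewrite -span_cons; apply: IHB => C sCB szC.
  rewrite (@perm_free _ _ _ (v :: (b :: C) ++ E)).
    by apply: freeC; rewrite /= ?eqxx ?szC.
  by rewrite perm_cons perm_catC /= perm_cons perm_catC.
rewrite -(subrK (lform b * h) g); have [_ ID IM] := star_ideal_ideal <<E>> c.+1 (b :: B).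
apply: ID; first exact: star_ideal_consl.
apply: star_ideal_consr.
(* Cancelling b in b * (v * h - h1), an element of the ideal of codimension c. *)
have [g1 [h1 [Ig1 Ih1 Dvbh]]] : star_ideal <<E>> c.+1 (b :: B) (lform v * (lform b * h)).
  have -> : lform v * (lform b * h) = lform v * g - lform v * (g - lform b * h) by ring.
  by apply: ideal_sub => //; apply: IM; apply: star_ideal_consl.
have /IHB : star_ideal <<E>> c B (lform b * (lform v * h - h1)).
  by have -> : lform b * (lform v * h - h1) = g1 by rewrite mulrBr mulrCA Dvbh addrK.
move=> /(_ _)/star_idealS Ivh1; apply: (IHB c.+1 E v) => [C sCB szC|].
  by apply: freeC => //; apply: subseq_trans sCB (subseq_cons _ _).
rewrite -(subrK h1 (lform v * h)); have [_ JD _] := star_ideal_ideal <<E>> c.+1 B.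
apply: JD => //; apply: Ivh1 => C sCB szC.
have := freeC (b :: C); rewrite free_cons /= eqxx szC => /(_ sCB erefl)/andP[] //.
Qed.

(** A prime above b * J contains b or J, for each member b of B in turn. *)
Lemma star_ideal_prime U P c B :
    is_prime_ideal P -> (forall f, star_ideal U c B f -> P f) ->
  exists C, [/\ subseq C B, size C = c & forall w, w \in C -> P (lform w)].
Proof.
move=> primeP; have [_ nP1 mulP] := primeP.
elim: B c => [|b B IHB] [|c] sIP; do ?by exists [::]; split=> //; rewrite sub0seq.
  by case: nP1; apply: sIP.
have [Pb | nPb] := classic (P (lform b)).
  have [|C [sCB szC CP]] := IHB c; first by move=> f /star_ideal_consl/sIP.
  exists (b :: C); split; rewrite /= ?eqxx ?szC // => w.
  by rewrite inE => /predU1P[-> | /CP].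
have [|C [sCB szC CP]] := IHB c.+1.
  by move=> f If; case: (mulP (lform b) f) => //; apply: sIP; apply: star_ideal_consr.
by exists C; split=> //; apply: subseq_trans sCB (subseq_cons _ _).
Qed.

Lemma star_ideal_take U c B f : (c <= size B)%N ->
  star_ideal U c B f -> linear_ideal (<<take c B>> + U) f.
Proof.
elim: B c f => [|b B IHB] [|c] f //=; rewrite ?span_nil ?add0v //.
move=> lec [g [h [Ig _ ->]]]; rewrite span_cons.
have [_ ID _] := linear_ideal_ideal (<[b]> + <<take c B>> + U).
apply: ID; first by apply: linear_ideal_mono (IHB _ _ lec Ig); rewrite -addvA addvSr.
apply: ideal_mulr; first exact: linear_ideal_ideal.
apply/linear_ideal_lform; rewrite -addvA.
by apply: subvP (addvSl _ _) _ (memv_line b).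
Qed.

Lemma star_ideal_adjoin (I : {mpoly K[k]} -> Prop) c B E f :
    (forall f, I f <-> star_ideal 0 c B f) ->
  ideal_adjoin I [seq lform z | z <- E] f <-> star_ideal <<E>> c B f.
Proof.
move=> IE; split=> [/(_ _ (star_ideal_ideal <<E>> c B))|].
  apply=> g [/IE|/mapP[z Ez ->]]; first by apply: star_ideal_mono; apply: sub0v.
  by apply/star_ideal_linear/linear_ideal_lform/memv_span.
elim: E f => [|z E IHE] f; first by rewrite span_nil => /IE If; apply: ideal_gen_mem; left.
rewrite span_cons => /star_ideal_add[h /IHE adjf].
have [_ ID IM] := ideal_gen_ideal (fun f => I f \/ f \in [seq lform z | z <- z :: E]).
rewrite -(subrK (lform z * h) f); apply: ID.
  by apply: ideal_genS adjf => g [Ig|Eg]; [left | right; rewrite /= inE Eg orbT].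
by rewrite mulrC; apply: IM; apply: ideal_gen_mem; right; rewrite /= inE eqxx.
Qed.

(** The chain is obtained by adjoining independent linear forms one by one. *)
Lemma linear_ideal_chain E : free E -> has_prime_chain (linear_ideal <<E>>) (k - size E).
Proof.
move Dd: (k - size E)%N => d; elim: d E Dd => [|d IHd] E Dd freeE.
  exact: (has_prime_chain0 (linear_ideal_prime <<E>>)).
have /subvPn[v _ nEv] : ~~ (fullv <= <<E>>)%VS.
  apply: contraL (eqxx d.+1) => /dimvS; rewrite (eqP freeE) dimvf /dim /= mul1n -subn_eq0 Dd.
  by move/eqP.
have freevE : free (v :: E) by rewrite free_cons nEv.
apply: (has_prime_chain_cons (linear_ideal_prime <<E>>) _ _ _ (IHd (v :: E) _ freevE)) => //.
- by move=> f; apply: linear_ideal_mono; rewrite span_cons addvSr.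
- move=> /(_ (lform v)) Ev; case/negP: nEv; apply/linear_ideal_lform/Ev.
  by apply/linear_ideal_lform/memv_span; rewrite mem_head.
- by rewrite /= subnS Dd.
Qed.

End StarIdeals.

(** * Vectors in general position *)

(** A vector on the moment curve lies in a proper subspace only if its parameter is
    a root of some nonzero polynomial. *)
Lemma avoid_subspaces (K : fieldType) (charK0 : [pchar K] =i pred0) k
    (S : seq {vspace 'rV[K]_k}) :
  (forall U, U \in S -> (\dim U < k)%N) -> exists v, forall U, U \in S -> v \notin U.
Proof.
move=> properS; pose curve t : 'rV[K]_k := \row_j t ^+ j.
have hyperplane (U : {vspace 'rV[K]_k}) : (\dim U < k)%N ->
    exists2 p : {poly K}, p != 0 & forall t, curve t \in U -> root p t.
  move=> ltUk; have /subvPn[w _ nUw] : ~~ (fullv <= U)%VS.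
    by apply: contraL ltUk => /dimvS; rewrite dimvf /dim /= mul1n leqNgt.
  pose q := (\1 - projv U)%VF.
  have qE v : q v = v - projv U v by rewrite /q add_lfunE opp_lfunE id_lfunE.
  have [j nzwj] : exists j, q w 0 j != 0.
    apply/rV0Pn; apply: contra nUw; rewrite qE subr_eq0 => /eqP ->; exact: memv_proj.
  have q_sum v : q v 0 j = \sum_i v 0 i * q (delta_mx 0 i) 0 j.
    rewrite {1}(row_sum_delta v) linear_sum summxE; apply: eq_bigr => i _.
    by rewrite linearZ mxE.
  pose p := \poly_(i < k) (if insub i is Some i' then q (delta_mx 0 i') 0 j else 0).
  have pE t : p.[t] = q (curve t) 0 j.
    rewrite horner_poly q_sum; apply: eq_bigr => i _; rewrite insubT // => lti /=.
    by rewrite mxE mulrC; congr (_ * q (delta_mx 0 _) 0 j); apply: val_inj.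
  exists p => [|t Uct]; last by rewrite rootE pE qE projv_id // subrr mxE.
  apply: contraNneq nzwj => p0; rewrite q_sum big1 // => i _.
  have := coef_poly k (fun i => if insub i is Some i' then q (delta_mx 0 i') 0 j else 0) i.
  rewrite -/p p0 coef0 ltn_ord insubT // => lti.
  by rewrite (_ : Sub _ _ = i) => [<-|]; [rewrite mulr0 | apply: val_inj].
have [p nzp rootp] : exists2 p : {poly K}, p != 0 &
    forall U t, U \in S -> curve t \in U -> root p t.
  elim: S properS => [|U S IHS] properS; first by exists 1; rewrite ?oner_eq0.
  have [|p nzp rootp] := IHS; first by move=> V SV; rewrite properS // inE SV orbT.
  have [|q nzq rootq] := hyperplane U; first by rewrite properS // mem_head.
  exists (p * q) => [|V t]; first by rewrite mulf_neq0.
  by rewrite inE rootM => /predU1P[-> /rootq -> | SV /(rootp _ _ SV) ->]; rewrite ?orbT.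
(* In characteristic 0 the images of the natural numbers below size p are too many to
   be all roots of p. *)
pose rs : seq K := [seq i%:R | i <- iota 0 (size p)].
have uniq_rs : uniq rs.
  rewrite map_inj_uniq ?iota_uniq // => i j /eqP.
  wlog leij : i j / (i <= j)%N => [IH|].
    by case/orP: (leq_total i j) => /IH H; [|rewrite eq_sym]; move=> /H.
  rewrite eq_sym -subr_eq0 -natrB // ((pcharf0P K).1 charK0) subn_eq0 => leji.
  by apply/eqP; rewrite eqn_leq leij.
have /allPn[t _ nroot] : ~~ all (root p) rs.
  apply/negP => /(max_poly_roots nzp)/(_ uniq_rs).
  by rewrite size_map size_iota ltnn.
exists (curve t) => U SU; apply: contra nroot; exact: rootp SU.
Qed.

Lemma ex_common_complement (K : fieldType) (charK0 : [pchar K] =i pred0) k c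
    (S : seq (seq 'rV[K]_k)) :
    (forall C, C \in S -> free C /\ size C = c) ->
  exists E, size E = (k - c)%N /\ forall C, C \in S -> free (E ++ C).
Proof.
move=> freeS; suff ex e : (e <= k - c)%N ->
    exists E, size E = e /\ forall C, C \in S -> free (E ++ C) by exact: ex.
elim: e => [|e IHe] le_e.
  by exists [::]; split=> // C /freeS[].
have [E [szE freeES]] := IHe (ltnW le_e).
have [|v Sv] := @avoid_subspaces K charK0 k [seq <<E ++ C>>%VS | C <- S].
  move=> _ /mapP[C SC ->]; apply: leq_ltn_trans (dim_span _) _.
  by rewrite size_cat szE (freeS C SC).2 addnC -ltn_subRL.
exists (v :: E); rewrite /= szE; split=> // C SC; rewrite free_cons freeES // andbT.
by apply: Sv; apply: map_f.
Qed.

(** * Star configurations are Cohen-Macaulay *)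

Lemma subseq_in (T : eqType) (C B : seq T) :
  subseq C B = (C \in [seq mask (tval m) B | m : (size B).-tuple bool]).
Proof.
apply/subseqP/mapP => [[m szm ->]|[m _ ->]]; last by exists (tval m); rewrite ?size_tuple.
by exists (tcast szm (in_tuple m)); rewrite ?mem_enum ?val_tcast.
Qed.

(** The dimension is that of any component; a regular sequence of this length is
    given by linear forms in general position with the members of B. *)
Lemma star_ideal_cohen_macaulay (K : fieldType) (charK0 : [pchar K] =i pred0) k c
    (B : seq 'rV[K]_k) (I : {mpoly K[k]} -> Prop) :
    (c <= size B)%N -> (forall C, subseq C B -> size C = c -> free C) ->
    (forall f, I f <-> star_ideal 0 c B f) ->
  cohen_macaulay_quot (irrelevant_ideal K k) I.
Proof.
move=> lecB freeB IE; right; exists (k - c)%N.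
have idI : is_ideal I.
  have [I0 ID IM] := star_ideal_ideal 0 c B.
  by split=> [|f g /IE If /IE Ig|r f /IE If]; apply/IE; [|exact: ID|exact: IM].
have dim_le d : has_prime_chain I d -> (d <= k - c)%N.
  apply: prime_chain_length => P primeP sIP.
  have [|C [sCB szC CP]] := @star_ideal_prime K k 0 P c B primeP; first by move=> f /IE/sIP.
  exists <<C>>%VS; split=> [|u Cu]; first by rewrite (eqP (freeB C sCB szC)).
  have [idP _ _] := primeP.
  rewrite (coord_span (X := in_tuple C) Cu) linear_sum; apply: ideal_sum => // i _.
  rewrite linearZ /= -mul_mpolyC; have [_ _ PM] := idP; apply: PM; apply: CP.
  exact: mem_nth.
have sz_take : size (take c B) = c by rewrite size_takel.
have freeT : free (take c B) by apply: freeB; rewrite ?take_subseq.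
have Itake f : I f -> linear_ideal <<take c B>> f.
  by move/IE/(star_ideal_take lecB); rewrite addv0.
have primem := irrelevant_ideal_prime K k.
have mform v : irrelevant_ideal K k (lform v).
  by apply/irrelevant_idealE/linear_ideal_lform/memvf.
have sIm f : I f -> irrelevant_ideal K k f.
  by move/Itake => If; apply/irrelevant_idealE; apply: linear_ideal_mono (subvf _) If.
split; first split=> //.
  by apply: (has_prime_chain_mono Itake); have := linear_ideal_chain freeT; rewrite sz_take.
split=> [|e [s [<- ms regs]]]; last first.
  apply: dim_le; apply: (@has_prime_chain_mono _ _ (colon I 1)) => [f|].
    by rewrite /colon mulr1.
  apply: (regular_sequence_chain (@mpoly_noetherian K k) primem) => // f.
  by rewrite /colon mulr1; apply: sIm.
have [C|E [szE freeE]] := @ex_common_complement K charK0 k c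
    [seq C <- [seq mask (tval m) B | m : (size B).-tuple bool] | size C == c].
  by rewrite mem_filter -subseq_in => /andP[/eqP szC sCB]; rewrite freeB.
exists [seq lform z | z <- E]; split=> [|_ /mapP[z _ ->] //|]; first by rewrite size_map.
split=> [i|adj1]; last first.
  have [_ nm1 _] := primem; apply: nm1; apply: adj1 => [|f [/sIm //|/mapP[z _ ->] //]].
  by case: primem.
rewrite size_map => lti g; rewrite -map_take (nth_map 0) // => /(star_ideal_adjoin _ _ IE) Ig.
apply/(star_ideal_adjoin _ _ IE); apply: star_ideal_regular Ig => C sCB szC.
have /freeE : C \in [seq C <- [seq mask (tval m) B | m : (size B).-tuple bool] | size C == c].
  by rewrite mem_filter szC eqxx -subseq_in.
rewrite -{1}(cat_take_drop i.+1 E) (take_nth 0) // -cats1 -catA.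
rewrite (perm_free (permEl (perm_catCA _ _ _))) => /catr_free; rewrite -catA.
by rewrite (@perm_free _ _ _ (E`_i :: C ++ take i E)) // perm_catC.
Qed.

(** * Ideals generated by products of linear forms *)

Lemma subseq_map_ex (T S : eqType) (h : T -> S) (t : seq T) C :
  subseq C [seq h i | i <- t] -> exists2 s, subseq s t & C = [seq h i | i <- s].
Proof.
move=> /subseqP[m szm ->]; exists (mask m t); last by rewrite map_mask.
exact: mask_subseq.
Qed.

Section ProductIdeals.
Variables (K : fieldType) (k n : nat).
Implicit Types (v : 'I_n -> 'rV[K]_k) (A D : {set 'I_n}) (r s : seq 'I_n).

Lemma star_ideal_prod v A c r :
  (count [pred i | i \notin A] r < c)%N ->
  star_ideal 0 c [seq v i | i <- r] (\prod_(i <- r | i \in A) lform (v i)).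
Proof.
elim: r c => [|i r IHr] [|c] //=; rewrite big_cons; case: ifP => iA /= ltc.
  by apply: star_ideal_consr; apply: IHr.
by apply: star_ideal_consl; apply: IHr.
Qed.

(** The factor x collects the members of the list that the induction has put into the
    product. *)
Lemma star_ideal_prod_min v c r (Q : {mpoly K[k]} -> Prop) x f :
    is_ideal Q -> uniq r ->
    (forall A, (count [pred i | i \notin A] r < c)%N ->
       Q (x * \prod_(i <- r | i \in A) lform (v i))) ->
  star_ideal 0 c [seq v i | i <- r] f -> Q (x * f).
Proof.
move=> idQ; elim: r c x f => [|i r IHr] [|c] x f //= => [_ _|_ Qx _|_ _|/andP[nir uniq_r] Qx].
1,3: by move/linear_ideal0=> ->; rewrite mulr0; case: idQ.
  by have := Qx set0 isT; rewrite big_nil mulr1; apply: ideal_mulr.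
have eq_r (A B : {set 'I_n}) : {in r, A =i B} ->
    (count [pred i | i \notin A] r = count [pred i | i \notin B] r) *
    (\prod_(j <- r | j \in A) lform (v j) = \prod_(j <- r | j \in B) lform (v j)).
  move=> eqAB; split; first by apply: eq_in_count => j rj /=; rewrite eqAB.
  rewrite big_seq_cond [RHS]big_seq_cond; apply: eq_bigl => j.
  by case rj: (j \in r); rewrite //= eqAB.
move=> [g [h [Ig Ih ->]]]; rewrite mulrDr; case: (idQ) => _ QD _; apply: QD.
  apply: (IHr c) Ig => // A ltA.
  have eqA : {in r, A =i A :\ i}.
    by move=> j rj; rewrite !inE; case: eqP rj => // ->; rewrite (negPf nir).
  have := Qx (A :\ i); rewrite big_cons !inE eqxx /= !(eq_r _ _ eqA) add1n ltnS.
  by apply; rewrite -(eq_r _ _ eqA).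
rewrite mulrA; apply: (IHr c.+1) Ih => // A ltA; rewrite -mulrA.
have eqA : {in r, A =i i |: A}.
  by move=> j rj; rewrite !inE; case: eqP rj => // ->; rewrite (negPf nir).
have := Qx (i |: A); rewrite big_cons !inE eqxx /= !(eq_r _ _ eqA) add0n.
by apply; rewrite -(eq_r _ _ eqA).
Qed.

Lemma count_predC_enum A D : count [pred i | i \notin A] (enum D) = #|D :\: A|.
Proof.
rewrite -sum1_count big_enum_cond /= -sum1_card; apply: eq_bigl => i.
by rewrite !inE andbC.
Qed.

Lemma prod_enum_cond (F : 'I_n -> {mpoly K[k]}) A D :
  \prod_(i <- enum D | i \in A) F i = \prod_(i in A :&: D) F i.
Proof. by rewrite big_enum_cond; apply: eq_bigl => i; rewrite inE andbC. Qed.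

Lemma product_ideal_mem (l : 'I_n -> {mpoly K[k]}) a A :
  (a <= #|A|)%N -> product_ideal l a (\prod_(i in A) l i).
Proof.
move=> /card_geqP[s [uniq_s szs sA]].
rewrite (bigID (fun i => i \in s)) /=.
apply: (@ideal_mulr _ (product_ideal l a)); first exact: ideal_gen_ideal.
apply: ideal_gen_mem; exists [set i in s]; split; first by rewrite cardsE (card_uniqP uniq_s).
by apply: eq_bigl => i; rewrite inE andbC; case si: (i \in s); rewrite //= sA.
Qed.

Lemma card_compl_le A a : #|A| = (n - a)%N -> (#|~: A| <= a)%N.
Proof. by move=> cA; have := cardsC A; rewrite card_ord cA => /esym; lia. Qed.

End ProductIdeals.

(** * The two Cohen-Macaulay cases *)

Section Arrangement.
Variables (K : fieldType) (k n : nat) (v : 'I_n -> 'rV[K]_k).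
Let l i := lform (v i).

Lemma three_generic_cohen_macaulay (charK0 : [pchar K] =i pred0) :
    (3 <= n)%N ->
    (forall i1 i2 i3 : 'I_n, (i1 < i2 < i3)%N -> free [:: v i1; v i2; v i3]) ->
  cohen_macaulay_quot (irrelevant_ideal K k) (product_ideal l (n - 2)).
Proof.
move=> le3n free3; apply: (@star_ideal_cohen_macaulay _ charK0 _ 3 [seq v i | i <- enum 'I_n]).
- by rewrite size_map size_enum_ord.
- move=> _ /subseq_map_ex[s /[dup] sub_s /(map_subseq val) + ->]; rewrite size_map => + szs.
  case: s szs sub_s => [|i1 [|i2 [|i3 [|]]]] //= _ _.
  rewrite val_enum_ord => /(subseq_sorted ltn_trans)/(_ (iota_ltn_sorted 0 n)).
  move=> /= /and3P[lt12 lt23 _].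
  by apply: free3; rewrite lt12.
have enumT : enum 'I_n = enum [set: 'I_n] by apply: eq_enum => i; rewrite !inE.
move=> f; split=> [|If].
  apply=> [|_ [A [cA ->]]]; first exact: star_ideal_ideal.
  rewrite enumT; have := @star_ideal_prod K k n v A 3 (enum [set: 'I_n]).
  rewrite count_predC_enum prod_enum_cond setTD setIT.
  by apply; apply: leq_ltn_trans (card_compl_le cA) _.
rewrite -[f]mul1r; apply: (star_ideal_prod_min _ _ _ If).
- exact: ideal_gen_ideal.
- exact: enum_uniq.
rewrite enumT => A; rewrite count_predC_enum setTD mul1r prod_enum_cond setIT => ltA.
apply: product_ideal_mem; have := cardsC A; rewrite card_ord; lia.
Qed.

(** A product containing the form of index o misses two other forms, of which it is a
    combination; so it is a combination of products of n - 2 of the other n - 1 forms.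
    Hence the ideal is the star ideal of codimension 2 of these. *)
Lemma rank2_cohen_macaulay (charK0 : [pchar K] =i pred0) :
    (2 <= n)%N -> (forall i j, i != j -> free [:: v i; v j]) ->
    (forall i j o, i != j -> v o \in (<[v i]> + <[v j]>)%VS) ->
  cohen_macaulay_quot (irrelevant_ideal K k) (product_ideal l (n - 2)).
Proof.
move=> le2n free2 dep3; have [n2|ne2] := eqVneq n 2.
  left; apply: ideal_gen_mem; exists set0; rewrite big_set0 cards0; split=> //; lia.
have o : 'I_n by case: n le2n => // n' _; exact: ord0.
pose D := [set~ o].
have cD : #|D| = n.-1 by rewrite cardsC1 card_ord.
apply: (@star_ideal_cohen_macaulay _ charK0 _ 2 [seq v i | i <- enum D]).
- by rewrite size_map -cardE cD; lia.
- move=> _ /subseq_map_ex[s sub_s ->]; rewrite size_map => szs.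
  have := subseq_uniq sub_s (enum_uniq D).
  case: s szs {sub_s} => [|i [|j [|]]] //= _; rewrite inE andbT; exact: free2.
have in_star (A : {set 'I_n}) : o \notin A -> (#|D :\: A| < 2)%N ->
    star_ideal 0 2 [seq v i | i <- enum D] (\prod_(i in A) l i).
  move=> nAo cDA; have := @star_ideal_prod K k n v A 2 (enum D).
  rewrite count_predC_enum prod_enum_cond.
  have -> : A :&: D = A.
    by apply/setIidPl/subsetP => i Ai; rewrite !inE; apply: contraNneq nAo => <-.
  exact.
move=> f; split=> [|If].
  apply=> [|_ [A [cA ->]]]; first exact: star_ideal_ideal.
  have cAC := card_compl_le cA.
  have DA : D :\: A = ~: (o |: A) by apply/setP => i; rewrite !inE negb_or andbC.
  have [Ao | nAo] := boolP (o \in A); last first.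
    apply: in_star => //; rewrite DA; have := cardsC (o |: A); have := cardsC A.
    by rewrite cardsU1 nAo add1n !card_ord cA; lia.
  have c2 : #|~: A| = 2 by have := cardsC A; rewrite card_ord; lia.
  have /cards2P[i [j [nij DAC]]] : #|~: A| == 2 by rewrite c2.
  have swap p : p \in ~: A ->
      star_ideal 0 2 [seq v i | i <- enum D] (l p * \prod_(i in A :\ o) l i).
    rewrite inE => nAp; rewrite -big_setU1 /=; last by rewrite !inE negb_and nAp orbT.
    have npo : p != o by apply: contraNneq nAp => ->.
    apply: in_star; first by rewrite !inE eqxx (eq_sym o) (negPf npo).
    rewrite (_ : D :\: _ = ~: A :\ p); last first.
      apply/setP => q; rewrite !inE; case: (q =P o) => [->|] /=; last first.
        by rewrite !negb_or andbT; case: (q == p).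
      by rewrite Ao !andbF.
    by have := cardsD1 p (~: A); rewrite c2 inE nAp add1n => -[<-].
  rewrite (big_setD1 o) //=.
  have /memv_addP[_ /vlineP[a ->] [_ /vlineP[b ->] Do]] := dep3 i j o nij.
  rewrite /l Do linearD !linearZ /= mulrDl -!scalerAl -!mul_mpolyC.
  have [_ ID IM] := star_ideal_ideal 0 2 [seq v i | i <- enum D].
  by apply: ID; apply: IM; apply: swap; rewrite DAC !inE eqxx ?orbT.
rewrite -[f]mul1r; apply: (star_ideal_prod_min _ _ _ If).
- exact: ideal_gen_ideal.
- exact: enum_uniq.
move=> A; rewrite count_predC_enum mul1r prod_enum_cond => ltA.
apply: product_ideal_mem; have := cardsID A D; rewrite setIC cD; lia.
Qed.

End Arrangement.

(** * Three dependent forms among forms of rank at least three *)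

Section LowestDegree.
Variables (K : fieldType) (k : nat).
Implicit Types (f g u : {mpoly K[k]}).

Definition low_degree d f : Prop := forall m, m \in msupp f -> (d <= mdeg m)%N.

Lemma low_degreeM d e f g : low_degree d f -> low_degree e g -> low_degree (d + e) (f * g).
Proof.
move=> df eg _ /msuppM_le/allpairsP[[m1 m2] [/= /df dm1 /eg em2 ->]].
by rewrite mdegD leq_add.
Qed.

Lemma low_degree_ideal d : is_ideal (low_degree d).
Proof.
split=> [m|f g df dg m|r f df]; first by rewrite msupp0.
  by move=> /msuppD_le; rewrite mem_cat => /orP[/df | /dg].
by apply: (@low_degreeM 0).
Qed.

Lemma dhomog_low_degree d f : f \is d.-homog -> low_degree d f.
Proof. by move=> homf m fm; rewrite (dhomog_mf homf fm). Qed.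

Lemma dhomog_prod_set n (l : 'I_n -> {mpoly K[k]}) (A : {set 'I_n}) :
  (forall i, l i \is 1.-homog) -> \prod_(i in A) l i \is #|A|.-homog.
Proof.
move=> hom1; rewrite -sum1_card.
apply: (big_ind2 (fun d f => f \is d.-homog)) => // [|d f e g df eg]; first exact: dhomog1.
exact: dhomogM.
Qed.

Lemma irrelevant_ideal_coef0 u : u@_0 = 0 -> irrelevant_ideal K k u.
Proof.
move=> u0; suff : irrelevant_ideal K k (u - u@_0 *: 1) by rewrite u0 scale0r subr0.
have [I0 ID IM] : is_ideal (irrelevant_ideal K k) by exact: ideal_gen_ideal.
rewrite -mul_mpolyC mulr1 {u0}.
elim/mpoly_ring_ind: u => [c|j|f g If Ig|f g If Ig].
- by rewrite mcoeffC eqxx mulr1 subrr.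
- by rewrite mcoeffX mnm1_eq0 mpolyC0 subr0; apply: ideal_gen_mem; exists j.
- by rewrite mcoeffD mpolyCD opprD addrACA; apply: ID.
- rewrite [(f * g)@_0]rmorphM mpolyCM.
  have -> : f * g - (f@_0)%:MP * (g@_0)%:MP =
      f * (g - (g@_0)%:MP) + (g@_0)%:MP * (f - (f@_0)%:MP) by ring.
  by apply: ID; apply: IM.
Qed.

(** The part of degree d of u * f is the constant term of u times f. *)
Lemma colon_low_degree d f u :
  f != 0 -> f \is d.-homog -> low_degree d.+1 (u * f) -> irrelevant_ideal K k u.
Proof.
move=> nzf homf lowuf; apply: irrelevant_ideal_coef0.
have fm : f@_(mlead f) != 0 by rewrite mleadc_eq0.
have degm : mdeg (mlead f) = d by apply: (dhomog_mf homf); apply: mlead_supp.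
have zero g : low_degree d.+1 g -> g@_(mlead f) = 0.
  by move=> lowg; apply: memN_msupp_eq0; apply/negP => /lowg; rewrite degm ltnn.
have lowu : low_degree d.+1 ((u - (u@_0)%:MP) * f).
  apply: (@low_degreeM 1 d) (dhomog_low_degree homf) => m.
  rewrite lt0n mdeg_eq0; apply: contraL => /eqP ->.
  by rewrite mcoeff_msupp mcoeffB mcoeffC eqxx mulr1 subrr eqxx.
have := zero _ lowu; rewrite mulrBl mcoeffB zero // mul_mpolyC mcoeffZ sub0r => /eqP.
by rewrite oppr_eq0 mulf_eq0 (negPf fm) orbF => /eqP.
Qed.

End LowestDegree.

Section NotCohenMacaulay.
Variables (K : fieldType) (k n : nat) (v : 'I_n -> 'rV[K]_k).
Let l i := lform (v i).

(** The three dependent forms bound the dimension from below by k - 2, and the product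
    of the forms other than the three independent ones, an element of R / I
    annihilated by the latter, bounds the depth from above by k - 3. *)
Lemma dependent_not_cohen_macaulay (i1 i2 i3 j1 j2 j3 : 'I_n) :
    uniq [:: i1; i2; i3] -> free [:: v i1; v i2] -> v i3 \in <<[:: v i1; v i2]>>%VS ->
    uniq [:: j1; j2; j3] -> free [:: v j1; v j2; v j3] -> (forall i, v i != 0) ->
  ~ cohen_macaulay_quot (irrelevant_ideal K k) (product_ideal l (n - 2)).
Proof.
move=> uniq_i free_i dep_i uniq_j free_j nz_v CM.
set I := product_ideal _ _ in CM.
have idI : is_ideal I by exact: ideal_gen_ideal.
have card3 (s : seq 'I_n) : uniq s -> #|[set i in s]| = size s.
  by move=> us; rewrite cardsE (card_uniqP us).
pose U := <<[:: v i1; v i2]>>%VS.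
have IU f : I f -> linear_ideal U f.
  apply=> [|_ [A [cA ->]]]; first exact: linear_ideal_ideal.
  have [i] : exists2 i, i \in A & i \in [set i in [:: i1; i2; i3]].
    have [] := boolP [disjoint A & [set i in [:: i1; i2; i3]]]; last first.
      by rewrite -setI_eq0 => /set0Pn[i]; rewrite inE => /andP[Ai Si]; exists i.
    rewrite disjoint_sym disjoints_subset => /subset_leq_card; rewrite card3 //=.
    by rewrite leqNgt ltnS (card_compl_le cA).
  rewrite inE => Ai Si; rewrite (big_setD1 i) //=.
  apply: ideal_mulr; first exact: linear_ideal_ideal.
  apply/linear_ideal_lform; move: Si; rewrite !inE => /or3P[]/eqP -> //; apply: memv_span;
    by rewrite !inE eqxx ?orbT.
have lt3n : (3 <= n)%N.
  by rewrite -[leqRHS](card_ord n) -[leqLHS](card3 _ uniq_j) max_card.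
case: CM => [/IU U1|[d [[_ dimd] [[s [szs ms regs]] _]]]].
  by have [_ nU1 _] := linear_ideal_prime U; apply: nU1.
have le_d : (k - 2 <= d)%N.
  by apply/dimd/(has_prime_chain_mono IU); have := linear_ideal_chain free_i.
pose A := ~: [set i in [:: j1; j2; j3]].
pose f := \prod_(i in A) l i.
have cA : #|A| = (n - 3)%N.
  by have := cardsC [set i in [:: j1; j2; j3]]; rewrite card3 //= card_ord -/A; lia.
have hom_l i : l i \is 1.-homog.
  rewrite /l /lform; apply: rpred_sum => j _; apply: rpredZ.
  by rewrite dhomogX; apply/eqP/mdeg1.
have homf : f \is (n - 3).-homog by rewrite -cA; apply: dhomog_prod_set.
have nzf : f != 0.
  apply/prodf_neq0 => i _; rewrite /l -(linear0 (@lform K k)) (inj_eq (@lform_inj K k)).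
  exact: nz_v.
have Ifm u : colon I f u -> irrelevant_ideal K k u.
  move=> Iuf; apply: (colon_low_degree nzf homf); move: Iuf; rewrite -subSn // subSS.
  apply=> [|_ [B [cB ->]]]; first exact: low_degree_ideal.
  by apply: dhomog_low_degree; rewrite -cB; apply: dhomog_prod_set.
have If_l j : j \in [:: j1; j2; j3] -> colon I f (l j).
  move=> Sj; have nAj : j \notin A by rewrite !inE negbK; move: Sj; rewrite !inE.
  rewrite /colon -big_setU1 //; apply: product_ideal_mem.
  by rewrite cardsU1 nAj cA add1n; lia.
have primem := irrelevant_ideal_prime K k.
have chain := regular_sequence_chain (@mpoly_noetherian K k) primem idI ms regs Ifm.
have : (size s <= k - 3)%N.
  apply: prime_chain_length chain => P [idP _ _] sIP.
  exists <<[:: v j1; v j2; v j3]>>%VS; split=> [|u Su]; first by rewrite (eqP free_j).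
  rewrite (coord_span (X := in_tuple _) Su) linear_sum; apply: ideal_sum => // i _.
  rewrite linearZ /= -mul_mpolyC; case: idP => _ _; apply; apply: sIP.
  by case: i => -[|[|[|]]] //= _; apply: If_l; rewrite !inE eqxx ?orbT.
have : (3 <= k)%N.
  have := dimvS (subvf <<[:: v j1; v j2; v j3]>>%VS).
  by rewrite (eqP free_j) dimvf /dim /= mul1n.
by rewrite szs; move: le_d; lia.
Qed.

End NotCohenMacaulay.

(** * Rank and linear independence *)

Section Rank.
Variables (K : fieldType) (k n : nat) (v : 'I_n -> 'rV[K]_k).
Let M := \matrix_(i < n, j < k) v i 0 j.

Lemma free_row_free m (t : 'I_m -> 'I_n) :
  free [seq v (t a) | a <- enum 'I_m] = row_free (rowsub t M).
Proof.
have rowE a : row a (rowsub t M) = v (t a) by apply/rowP => j; rewrite !mxE.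
have nthE (a : 'I_m) : [tuple v (t a) | a < m]`_a = v (t a) by rewrite -tnth_nth tnth_mktuple.
rewrite -[LHS]/(free [tuple v (t a) | a < m]); apply/freeP/idP => [freev|/row_free_inj inj u].
  apply: inj_row_free => u uM0; apply/rowP => a; rewrite mxE; apply: (freev (fun a => u 0 a)).
  by rewrite -[RHS]uM0 mulmx_sum_row; apply: eq_bigr => b _; rewrite rowE nthE.
move=> sum0 a; have /inj/rowP/(_ a) : (\row_b u b) *m rowsub t M = 0 *m rowsub t M.
  rewrite mul0mx -sum0 mulmx_sum_row; apply: eq_bigr => b _.
  by rewrite rowE mxE nthE.
by rewrite !mxE.
Qed.

Lemma free_size_rank s : free [seq v i | i <- s] -> (size s <= \rank M)%N.
Proof.
move=> free_s; pose t := tnth (in_tuple s).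
have Ds : [seq t a | a <- enum 'I_(size s)] = s by rewrite (map_tnth_enum (in_tuple s)).
have : row_free (rowsub t M) by rewrite -free_row_free map_comp Ds.
by rewrite /row_free => /eqP <-; apply/mxrankS/rowsub_sub.
Qed.

Lemma ex_free_rank : exists s, size s = \rank M /\ free [seq v i | i <- s].
Proof.
exists [seq maxrankfun M a | a <- enum 'I_(\rank M)]; split.
  by rewrite size_map size_enum_ord.
by rewrite -map_comp free_row_free maxrowsub_free.
Qed.

End Rank.

(** * Dependencies *)

Lemma card_ord_pair n : #|ord_pair n| = 'C(n, 2).
Proof.
rewrite card_sig -bin2_sum big_mkord -sum1_card.
rewrite (eq_bigr (fun j : 'I_n => \sum_(i < n | (i < j)%N) 1)%N) => [|j _].
  by rewrite (exchange_big_dep xpredT) //= pair_big_dep.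
by rewrite -(big_ord_widen n (fun=> 1%N)) ?sum1_card ?card_ord // ltnW.
Qed.

Section Dependencies.
Variables (K : fieldType) (k n : nat) (l : 'I_n -> {mpoly K[k]}).
Hypothesis free2 : forall i j (a b : K), i != j -> a *: l i + b *: l j = 0 -> a = 0 /\ b = 0.

Lemma dependency_dim_eq0 : dependency_dim l = 0%N <-> three_generic l.
Proof.
have [mem_span min_span] := linear_spanP (is_dependency_vector l).
rewrite /dependency_dim; split=> [/eqP|generic].
  rewrite dimv_eq0 => /eqP span0 i1 i2 i3 lt123 c1 c2 c3 dep.
  have /andP[lt12 lt23] := lt123.
  have n12 : i1 != i2 by apply: contraTneq lt12 => ->; rewrite ltnn.
  have n23 : i2 != i3 by apply: contraTneq lt23 => ->; rewrite ltnn.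
  have n13 : i1 != i3 by apply: contraTneq (ltn_trans lt12 lt23) => ->; rewrite ltnn.
  have [c10|nz1] := eqVneq c1 0.
    by move: dep; rewrite c10 scale0r add0r => /(free2 n23)[].
  have [c20|nz2] := eqVneq c2 0.
    by move: dep; rewrite c20 scale0r addr0 => /(free2 n13)[].
  have [c30|nz3] := eqVneq c3 0.
    by move: dep; rewrite c30 scale0r addr0 => /(free2 n12)[].
  have : dependency_vector i1 i2 i3 c1 c2 c3 \in linear_span (is_dependency_vector l).
    by apply: mem_span; exists i1, i2, i3, c1, c2, c3.
  rewrite span0 memv0 => /eqP/ffunP/(_ (exist _ (i1, i2) lt12)).
  by rewrite !ffunE eqxx => /eqP; rewrite (negPf nz3).
apply/eqP; rewrite dimv_eq0 -subv0; apply: min_span.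
move=> u [i1 [i2 [i3 [c1 [c2 [c3 [[lt123 [nz1 _ _] dep] _]]]]]]].
by have [c10 _ _] := generic _ _ _ lt123 _ _ _ dep; rewrite c10 eqxx in nz1.
Qed.

Definition pair_prod (p : ord_pair n) : {mpoly K[k]} :=
  \prod_(s | (s != (val p).1) && (s != (val p).2)) l s.

(** The linear relation with coefficients u between the products of n - 2 forms. *)
Definition dependency_relation (u : {ffun ord_pair n -> K^o}) : {mpoly K[k]} :=
  \sum_p u p *: pair_prod p.

Lemma dependency_relation_linear : linear dependency_relation.
Proof.
move=> a u w; rewrite scaler_sumr -big_split /=; apply: eq_bigr => p _.
by rewrite !ffunE scalerDl scalerA.
Qed.

(** For a dependency vector this is c1 l1 + c2 l2 + c3 l3 = 0 multiplied by the other
    forms.  The relations are the common kernel of the coefficient functionals, hence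
    contain the span. *)
Lemma dependency_relation_span u :
  u \in linear_span (is_dependency_vector l) -> dependency_relation u = 0.
Proof.
have [_ min_span] := linear_spanP (is_dependency_vector l) => span_u.
apply/mpolyP => m; rewrite mcoeff0.
have lin_m : linear (fun u => (dependency_relation u)@_m : K^o).
  by move=> a x y; rewrite dependency_relation_linear mcoeffD mcoeffZ.
pose fm := GRing.isLinear.Build _ _ _ _ _ lin_m.
pose Fm : {linear _ -> _} := HB.pack (fun u => (dependency_relation u)@_m : K^o) fm.
suff /subvP/(_ u span_u) : (linear_span (is_dependency_vector l) <= lker (linfun Fm))%VS.
  by rewrite memv_ker lfunE /= => /eqP.
apply: min_span => _ [i1 [i2 [i3 [c1 [c2 [c3 [[/andP[lt12 lt23] _ dep] ->]]]]]]].
rewrite memv_ker lfunE /=.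
suff -> : dependency_relation (dependency_vector i1 i2 i3 c1 c2 c3) = 0 by rewrite mcoeff0.
have lt13 := ltn_trans lt12 lt23.
have n12 : i1 != i2 by apply: contraTneq lt12 => ->; rewrite ltnn.
have n23 : i2 != i3 by apply: contraTneq lt23 => ->; rewrite ltnn.
have n13 : i1 != i3 by apply: contraTneq lt13 => ->; rewrite ltnn.
pose p12 : ord_pair n := exist _ (i1, i2) lt12.
pose p13 : ord_pair n := exist _ (i1, i3) lt13.
pose p23 : ord_pair n := exist _ (i2, i3) lt23.
have neq (p q : ord_pair n) : (p == q) = (val p == val q) by [].
pose T := \prod_(s | [&& s != i1, s != i2 & s != i3]) l s.
have -> : dependency_relation (dependency_vector i1 i2 i3 c1 c2 c3) =
    c3 *: pair_prod p12 + (c2 *: pair_prod p13 + c1 *: pair_prod p23).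
  have n1312 : p13 != p12 by rewrite neq /= xpair_eqE eqxx eq_sym n23.
  have n2312 : p23 != p12 by rewrite neq /= xpair_eqE eq_sym (negPf n12).
  have n2313 : p23 != p13 by rewrite neq /= xpair_eqE eq_sym (negPf n12).
  rewrite /dependency_relation (bigD1 p12 isT) /= (bigD1 p13 n1312) /=.
  rewrite (bigD1 p23) ?n2312 //= big1 => [|p]; last first.
    rewrite !neq /= => /andP[/andP[n_12 n_13] n_23].
    by rewrite ffunE (negPf n_12) (negPf n_13) (negPf n_23) scale0r.
  by rewrite !ffunE /= !xpair_eqE !eqxx (eq_sym i3) (negPf n23) (eq_sym i2) (negPf n12) /= addr0.
have -> : pair_prod p12 = l i3 * T.
  rewrite /pair_prod (bigD1 i3) /=; last by rewrite eq_sym n13 eq_sym n23.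
  by congr (_ * _); apply: eq_bigl => s; rewrite andbA.
have -> : pair_prod p13 = l i2 * T.
  rewrite /pair_prod (bigD1 i2) /=; last by rewrite eq_sym n12 n23.
  by congr (_ * _); apply: eq_bigl => s; rewrite -andbA; congr (_ && _); rewrite andbC.
have -> : pair_prod p23 = l i1 * T.
  rewrite /pair_prod (bigD1 i1) /=; last by rewrite n12 n13.
  by congr (_ * _); apply: eq_bigl => s; rewrite andbC.
rewrite !scalerAl -!mulrDl [X in X * T](_ : _ = 0) ?mul0r //.
by rewrite -[RHS]dep addrC [c2 *: _ + _]addrC.
Qed.

End Dependencies.

Section RankTwoDependencies.
Variables (K : fieldType) (k n : nat) (v : 'I_n.+1 -> 'rV[K]_k).
Let l i := lform (v i).
Hypothesis free2 : forall i j, i != j -> free [:: v i; v j].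
Hypothesis dep3 : forall i j o, i != j -> v o \in (<[v i]> + <[v j]>)%VS.

Let V m := {ffun ord_pair m -> K^o}.

Lemma lift_pair_subproof (q : ord_pair n) :
  (lift ord0 (val q).1 < lift ord0 (val q).2)%N.
Proof. by rewrite !lift0 ltnS; case: q. Qed.

Definition lift_pair (q : ord_pair n) : ord_pair n.+1 :=
  exist _ (lift ord0 (val q).1, lift ord0 (val q).2) (lift_pair_subproof q).

Definition restrict_pairs (u : V n.+1) : V n := [ffun q => u (lift_pair q)].

Lemma restrict_pairs_linear : linear restrict_pairs.
Proof. by move=> a x y; apply/ffunP => q; rewrite !ffunE. Qed.
HB.instance Definition _ :=
  GRing.isLinear.Build K (V n.+1) (V n) _ restrict_pairs restrict_pairs_linear.

Lemma notin_line i j : i != j -> v i \notin <[v j]>%VS.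
Proof. by move=> /free2; rewrite free_cons span_seq1 => /andP[]. Qed.

(** Modulo the form of index j, all terms of the relation vanish but the one at the
    pair of the first index and j, whose product of forms does not. *)
Lemma restrict_pairs_inj u :
  dependency_relation l u = 0 -> restrict_pairs u = 0 -> u = 0.
Proof.
move=> relu resu; apply/ffunP => -[[i j] lt_ij]; rewrite [RHS]ffunE.
have u_lift q : u (lift_pair q) = 0 by have /ffunP/(_ q) := resu; rewrite !ffunE.
have lift_ord (p : ord_pair n.+1) : (val p).1 != ord0 -> u p = 0.
  case: p => -[a b] lt_ab /=.
  case: (unliftP ord0 a) lt_ab => [a' ->|->] lt_ab; last by rewrite eqxx.
  case: (unliftP ord0 b) lt_ab => [b' ->|->] lt_ab _; last by have := lt_ab.
  have lt_ab' : (a' < b')%N by exact: lt_ab.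
  by rewrite -(u_lift (exist _ (a', b') lt_ab')); congr (u _); apply: val_inj.
have [i0 | /(lift_ord (exist _ (i, j) lt_ij)) //] := eqVneq i ord0.
have [_ _ UM] := linear_ideal_ideal <[v j]>.
have [_ nU1 Uprime] := linear_ideal_prime <[v j]>.
have Ul p : j != (val p).1 -> j != (val p).2 -> linear_ideal <[v j]> (pair_prod l p).
  move=> n1 n2; rewrite /pair_prod (bigD1 j) ?n1 //= mulrC; apply: UM.
  exact/linear_ideal_lform/memv_line.
pose p0 : ord_pair n.+1 := exist _ (i, j) lt_ij.
have nij : i != j by apply: contraTneq (lt_ij) => /= ->; rewrite ltnn.
have Urest : linear_ideal <[v j]> (\sum_(p | p != p0) u p *: pair_prod l p).
  apply: (@ideal_sum _ (linear_ideal <[v j]>) _ _ _ _ (linear_ideal_ideal _)) => p np.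
  have [p1|/lift_ord ->] := eqVneq (val p).1 ord0; last first.
    by rewrite scale0r; apply: rmorph0.
  rewrite -mul_mpolyC; apply/UM/Ul; first by rewrite p1 -i0 eq_sym.
  apply: contraNneq np => j2; apply/eqP/val_inj.
  by rewrite [LHS]surjective_pairing p1 -j2 -i0.
have Up0 : linear_ideal <[v j]> (u p0 *: pair_prod l p0).
  have /eqP := relu; rewrite /dependency_relation (bigD1 p0 isT) /= addr_eq0 => /eqP ->.
  by apply: ideal_opp => //; apply: linear_ideal_ideal.
apply: NNPP => /eqP nz_u; have Uprod : linear_ideal <[v j]> (pair_prod l p0).
  by have := UM (u p0)^-1%:MP _ Up0; rewrite mul_mpolyC scalerA mulVf ?scale1r.
move: Uprod; apply: (big_ind (fun f => ~ linear_ideal <[v j]> f)) => //.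
  by move=> f g nf ng /Uprime[].
move=> s /= /andP[_ n2] /linear_ideal_lform; apply/negP; exact: notin_line.
Qed.

(** The dependency of the first form on those of indices i and j restricts to the basis
    vector at this pair, when normalized to have coefficient 1 at the first form. *)
Lemma restrict_pairs_surj w :
  exists2 u, u \in linear_span (is_dependency_vector l) & restrict_pairs u = w.
Proof.
set D := linear_span _; have [mem_span _] := linear_spanP (is_dependency_vector l).
suff delta q : exists2 u, u \in D & restrict_pairs u = [ffun q' => (q' == q)%:R].
  have /(_ _)/constructive_indefinite_description d q :
      exists u, u \in D /\ restrict_pairs u = [ffun q' => (q' == q)%:R].
    by have [u] := delta q; exists u.
  exists (\sum_q w q *: sval (d q)).
    by apply: memv_suml => q _; apply: memvZ; case: (svalP (d q)).
  rewrite linear_sum; apply/ffunP => q'; rewrite sum_ffunE (bigD1 q') //=.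
  rewrite linearZ /= (svalP (d q')).2 !ffunE eqxx big1 ?addr0 => [|q nq].
    by rewrite [LHS]mulr1.
  by rewrite linearZ /= (svalP (d q)).2 !ffunE eq_sym (negPf nq) scaler0.
case: q => -[i j] /= lt_ij.
have nij : lift ord0 i != lift ord0 j.
  by rewrite (inj_eq lift_inj); apply: contraTneq lt_ij => ->; rewrite ltnn.
have /memv_addP[_ /vlineP[a ->] [_ /vlineP[b ->] D0]] := dep3 ord0 nij.
have nza : a != 0.
  apply: contraTneq isT => a0; move: D0; rewrite a0 scale0r add0r => D0.
  by have := notin_line (neq_lift ord0 j); rewrite D0 memvZ // memv_line.
have nzb : b != 0.
  apply: contraTneq isT => b0; move: D0; rewrite b0 scale0r addr0 => D0.
  by have := notin_line (neq_lift ord0 i); rewrite D0 memvZ // memv_line.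
exists (dependency_vector ord0 (lift ord0 i) (lift ord0 j) 1 (- a) (- b)).
  apply: mem_span; exists ord0, (lift ord0 i), (lift ord0 j), 1, (- a), (- b); split=> //.
  split; [by rewrite !lift0 /= ltnS | by rewrite oner_eq0 !oppr_eq0 |].
  by rewrite /l D0 linearD !linearZ /= scale1r !scaleNr -addrA -opprD subrr.
apply/ffunP => -[[i' j'] lt_ij']; rewrite !ffunE /= !xpair_eqE.
rewrite !(inj_eq lift_inj) -[X in (nat_of_bool X)%:R]/((i', j') == (i, j)) xpair_eqE.
by case: andb.
Qed.

Lemma dependency_dim_rank2_succ : dependency_dim l = 'C(n, 2).
Proof.
rewrite /dependency_dim; set D := linear_span _.
rewrite -(@limg_dim_eq _ _ _ (linfun restrict_pairs) D); last first.
  apply/eqP; rewrite -subv0; apply/subvP => u; rewrite memv_cap memv_ker lfunE /= memv0.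
  case/andP=> Du /eqP resu; apply/eqP/restrict_pairs_inj => //.
  exact: dependency_relation_span Du.
have -> : (linfun restrict_pairs @: D)%VS = fullv.
  apply/eqP; rewrite eqEsubv subvf /=; apply/subvP => w _.
  have [u Du <-] := restrict_pairs_surj w.
  by rewrite -[restrict_pairs u](lfunE restrict_pairs) memv_img.
by rewrite dimvf /dim /= muln1 card_ord_pair.
Qed.

End RankTwoDependencies.

Lemma dependency_dim_rank2 (K : fieldType) (k n : nat) (v : 'I_n -> 'rV[K]_k) :
    (forall i j, i != j -> free [:: v i; v j]) ->
    (forall i j o, i != j -> v o \in (<[v i]> + <[v j]>)%VS) ->
  (0 < n)%N -> dependency_dim (fun i => lform (v i)) = 'C(n.-1, 2).
Proof. by case: n v => // n v free2 dep3 _; apply: dependency_dim_rank2_succ. Qed.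

Lemma free3P (K : fieldType) (V : vectType K) (a b c : V) :
  free [:: a; b; c] <->
  forall x y z : K, x *: a + y *: b + z *: c = 0 -> [/\ x = 0, y = 0 & z = 0].
Proof.
have sum3 (u : 'I_3 -> K) : \sum_i u i *: [tuple a; b; c]`_i =
    u ord0 *: a + u (lift ord0 ord0) *: b + u ord_max *: c.
  rewrite !big_ord_recl big_ord0 addr0 addrA /=.
  by congr (_ + u _ *: _); apply: val_inj.
split=> [/(@freeP _ _ _ [tuple a; b; c]) freeX x y z rel | freeX].
  have := freeX (fun i => [:: x; y; z]`_i); rewrite sum3 => /(_ rel) u0.
  by split; [apply: (u0 ord0) | apply: (u0 (lift ord0 ord0)) | apply: (u0 ord_max)].
apply/(@freeP _ _ _ [tuple a; b; c]) => u; rewrite sum3 => /freeX[u0 u1 u2].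
by case=> -[|[|[|]]] //= lti; [rewrite -[RHS]u0 | rewrite -[RHS]u1 | rewrite -[RHS]u2];
  congr (u _); apply: val_inj.
Qed.

Theorem corollary2p5 (K : fieldType) (charK0 : [pchar K] =i pred0)
    (k n : nat) (n_ge2 : (2 <= n)%N) (l : 'I_n -> {mpoly K[k]})
    (arrA : hyperplane_arrangement l) :
  (cohen_macaulay_quot (irrelevant_ideal K k) (product_ideal l (n - 2)%N) <->
     (arrangement_rank l = 2%N /\ dependency_dim l = 'C(n.-1, 2)%N) \/
     ((3 <= arrangement_rank l)%N /\ dependency_dim l = 0%N)) /\
  (dependency_dim l = 0%N <-> three_generic l).
Proof.
case: arrA => hom_l nz_l prop_l.
pose v i := lform_coord (l i).
have Dl : l = fun i => lform (v i).
  by apply: functional_extensionality => i; rewrite lform_coordK.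
have free2 i j : i != j -> free [:: v i; v j].
  move=> nij; rewrite free_cons span_seq1 seq1_free; apply/andP; split.
    by apply/vlineP => -[c Dvi]; apply: (prop_l i j nij c); rewrite Dl Dvi linearZ.
  by apply: contraNneq (nz_l j) => vj0; rewrite Dl vj0 linear0.
have indep2 i j a b : i != j -> a *: l i + b *: l j = 0 -> a = 0 /\ b = 0.
  move=> nij rel; have [a0 | nza] := eqVneq a 0.
    move: rel; rewrite a0 scale0r add0r => /eqP.
    by rewrite mscalerI (negPf (nz_l j)) orbF => /eqP.
  case: (prop_l i j nij (- (b / a))).
  rewrite scaleNr mulrC -scalerA -[b *: _](addKr (a *: l i)) rel addr0 scalerN opprK.
  by rewrite scalerA mulVf ?scale1r.
have genericP : three_generic l <->
    forall i1 i2 i3 : 'I_n, (i1 < i2 < i3)%N -> free [:: v i1; v i2; v i3].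
  have relE i1 i2 i3 a b c :
      a *: l i1 + b *: l i2 + c *: l i3 = lform (a *: v i1 + b *: v i2 + c *: v i3).
    by rewrite Dl !linearD !linearZ.
  split=> [gen | freev] i1 i2 i3 lt123.
    by apply/free3P => a b c rel; apply: gen lt123 _ _ _ _; rewrite relE rel linear0.
  move=> a b c; rewrite relE -(linear0 (@lform K k)) => /lform_inj.
  by have /free3P := freev _ _ _ lt123; apply.
have dim0P := dependency_dim_eq0 indep2.
split=> //.
have rankE : arrangement_rank l = \rank (\matrix_(i < n, j < k) v i 0 j).
  by congr (\rank _); apply/matrixP => i j; rewrite !mxE.
have rank_ge s : free [seq v i | i <- s] -> (size s <= arrangement_rank l)%N.
  by rewrite rankE; apply: free_size_rank.
have nz_v i : v i != 0.
  by apply: contraNneq (nz_l i) => vi0; rewrite Dl vi0 linear0.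
have rank_ge2 : (2 <= arrangement_rank l)%N.
  have n01 : Ordinal (ltnW n_ge2) != Ordinal n_ge2 by [].
  exact: (rank_ge [:: _; _] (free2 _ _ n01)).
have [rank3 | rank2] := leqP 3 (arrangement_rank l).
  split=> [CM | [[rank2 _] | [_ /dim0P/genericP]]]; last first.
  - rewrite Dl; apply: three_generic_cohen_macaulay => //.
    by apply: leq_trans rank3 _; rewrite rankE rank_leq_row.
  - by rewrite rank2 in rank3.
  right; split=> //; apply/dim0P/genericP => i1 i2 i3 /andP[lt12 lt23].
  have n12 : i1 != i2 by apply: contraTneq lt12 => ->; rewrite ltnn.
  have n23 : i2 != i3 by apply: contraTneq lt23 => ->; rewrite ltnn.
  have n13 : i1 != i3 by apply: contraTneq (ltn_trans lt12 lt23) => ->; rewrite ltnn.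
  apply: contraT => nfree.
  have dep : v i3 \in <<[:: v i1; v i2]>>%VS.
    move: nfree; rewrite (perm_free (_ : perm_eq _ [:: v i3; v i1; v i2])).
      by rewrite free_cons free2 // andbT negbK.
    by rewrite (perm_catC [:: v i1; v i2] [:: v i3]).
  have [s [szs free_s]] := ex_free_rank v; rewrite -rankE in szs.
  case: s szs free_s => [|j1 [|j2 [|j3 s]]] szs free_s; try by rewrite -szs in rank3.
  have free_j : free [:: v j1; v j2; v j3].
    by move: free_s; rewrite (map_cat v [:: j1; j2; j3] s) => /catl_free.
  have uniq_j : uniq [:: j1; j2; j3].
    exact: (@map_uniq _ _ v [:: j1; j2; j3] (free_uniq free_j)).
  case: (@dependent_not_cohen_macaulay K k n v i1 i2 i3 j1 j2 j3) => //; last by rewrite Dl in CM.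
    by rewrite /= !inE negb_or n12 n13 n23.
  exact: free2.
have {rank2} rank2 : arrangement_rank l = 2 by apply/eqP; rewrite eqn_leq rank_ge2 -ltnS rank2.
have dep3 i j o : i != j -> v o \in (<[v i]> + <[v j]>)%VS.
  move=> nij; apply: contraT => nvo; have := rank_ge [:: o; i; j].
  rewrite rank2 /= free_cons free2 // span_cons span_seq1 nvo => /(_ isT).
  by [].
split=> _.
  by left; split=> //; rewrite Dl dependency_dim_rank2 // ltnW.
rewrite Dl; exact: rank2_cohen_macaulay.
Qed.
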